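(* Let $n\ge 5$ be odd. For each of the following two choices of $(\alpha,\beta)$ the hypergeometric monodromy group $H(\alpha,\beta)$ is thin: (i) $\alpha=\left(0,\frac{1}{n+1},\frac{2}{n+1},\dots,\frac{n-1}{2(n+1)},\frac{n+3}{2(n+1)},\dots,\frac{n}{n+1}\right)$ (that is, $0$ together with all $\frac{k}{n+1}$, $1\le k\le n$, $k\ne\frac{n+1}{2}$), and $\beta=\left(\frac12,\frac1n,\frac2n,\dots,\frac{n-1}{n}\right)$; (ii) $\alpha=\left(\frac12,\frac{1}{2n-2},\frac{3}{2n-2},\dots,\frac{2n-3}{2n-2}\right)$ (that is, $\frac12$ together with all $\frac{k}{2n-2}$, $k$ odd, $1\le k\le 2n-3$), and $\beta=\left(0,0,0,\frac{1}{n-2},\frac{2}{n-2},\dots,\frac{n-3}{n-2}\right)$.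
   Context: For $\alpha,\beta\in(\mathbb Q\cap[0,1))^n$ (regarded as multisets) with $\alpha_i\neq\beta_j$ for all $i,j$, put $P(z)=\prod_{j}(z-e^{2\pi i\alpha_j})=z^n+A_1z^{n-1}+\cdots+A_n$ and $Q(z)=\prod_{j}(z-e^{2\pi i\beta_j})=z^n+B_1z^{n-1}+\cdots+B_n$, assumed to be products of cyclotomic polynomials. $H(\alpha,\beta)\subset \mathrm{GL}_n(\mathbb Z)$ is the group generated by the companion matrices $A$ and $B$ of $P$ and $Q$: $A e_i=e_{i+1}$ for $1\le i<n$ and $Ae_n=-A_ne_1-A_{n-1}e_2-\cdots-A_1e_n$; similarly for $B$ with the coefficients $B_i$. In the cases considered, $H(\alpha,\beta)$ preserves a nondegenerate rational quadratic form $f$ in $n$ variables, unique up to a scalar multiple, of signature $(n-1,1)$ after a suitable choice of sign, and the Zariski closure of $H(\alpha,\beta)$ is $G=\mathrm O_f$. Write $\mathrm O_f(\mathbb Z)=\{g\in\mathrm{GL}_n(\mathbb Z): f\circ g=f\}$. $H(\alpha,\beta)$ is called thin if it has infinite index in $G(\mathbb Z)=\mathrm O_f(\mathbb Z)$. *)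

(* Defs.v *)
From HB Require Import structures.
From mathcomp Require Import all_boot all_order all_algebra.
From mathcomp Require Import all_classical all_reals all_analysis.
From mathcomp Require Import complex.

Set Implicit Arguments.
Unset Strict Implicit.
Unset Printing Implicit Defensive.

Import Order.TTheory GRing.Theory Num.Theory.

Local Open Scope classical_set_scope.
Local Open Scope ring_scope.

(* e^{2 pi i a} *)
Definition cexp2pi (R : realType) (a : rat) : R[i] :=
  Complex (cos (2 * pi * ratr a : R)) (sin (2 * pi * ratr a : R)).

(* Multisets of exponents are sequences; nothing below depends on their order. *)
Definition exponent_poly (R : realType) (a : seq rat) : {poly R[i]} :=
  \prod_(x <- a) ('X - (cexp2pi R x)%:P).

(* Acts on column vectors by e_j |-> e_(j+1) for j < n and
   e_n |-> - (p_0 e_1 + ... + p_(n-1) e_n), where p_k is the coefficient of 'X^k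
   in the monic polynomial p of degree n. The library's [companionmx p] is the
   transpose of this matrix, in a dimension depending on [size p]. *)
Definition companion (K : nzRingType) (n : nat) (p : {poly K}) : 'M[K]_n :=
  \matrix_(i, j) (if j == n.-1 :> nat then - p`_i
                  else (i == j.+1 :> nat)%:R).

Arguments companion {K} n p.

Inductive generated (K : comUnitRingType) (n : nat) (S : set 'M[K]_n) :
    'M[K]_n -> Prop :=
| generated_in g of S g : generated S g
| generated1 : generated S 1%:M
| generatedM g h of generated S g & generated S h : generated S (g *m h)
| generatedV g of generated S g : generated S (invmx g).

(* H(a, b), meant for [size a = size b = n]. It is a set of complex matrices;
   that its elements lie in GL_n(Z) is part of [preserved_form] below. *)
Definition hypergeometric_group (R : realType) (n : nat) (a b : seq rat) :
    set 'M[R[i]]_n :=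
  generated [set companion n (exponent_poly R a);
                 companion n (exponent_poly R b)].

Arguments hypergeometric_group R n a b : clear implicits.

(* Rational quadratic forms are given by their symmetric Gram matrices. *)
Definition quadform (n : nat) (F : 'M[rat]_n) (x : 'cV[rat]_n) : rat :=
  (x^T *m F *m x) 0 0.

Definition has_signature (n : nat) (F : 'M[rat]_n) (p q : nat) : Prop :=
  exists (S : 'M[rat]_n) (d : 'rV[rat]_n),
    [/\ S \in unitmx, S^T *m F *m S = diag_mx d,
        #|[set i | 0 < d 0 i]%SET| = p & #|[set i | d 0 i < 0]%SET| = q].

(* O_f(Z), viewed inside GL_n(C) *)
Definition integral_orthogonal_group (R : realType) (n : nat) (F : 'M[rat]_n) :
    set 'M[R[i]]_n :=
  [set map_mx intr g | g in [set g : 'M[int]_n | g \in unitmx /\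
    forall x, quadform F (map_mx intr g *m x) = quadform F x]].

Arguments integral_orthogonal_group R {n} F.

Definition infinite_index (K : comUnitRingType) (n : nat)
    (H G : set 'M[K]_n) : Prop :=
  infinite_set [set [set g *m h | h in H] | g in G].

Definition preserved_form (R : realType) (n : nat) (H : set 'M[R[i]]_n)
    (F : 'M[rat]_n) : Prop :=
  [/\ F^T = F, F \in unitmx,
      has_signature F n.-1 1 \/ has_signature (- F) n.-1 1 &
      H `<=` integral_orthogonal_group R F].

(* The preserved form is determined by H only up to a scalar, hence the
   universal quantifier; the first conjunct keeps the second from being
   vacuous. *)
Definition thin (R : realType) (n : nat) (H : set 'M[R[i]]_n) : Prop :=
  (exists F : 'M[rat]_n, preserved_form H F) /\
  (forall F : 'M[rat]_n, preserved_form H F ->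
     infinite_index H (integral_orthogonal_group R F)).

Definition alpha1 (n : nat) : seq rat :=
  0 :: [seq k%:R / n.+1%:R | k <- iota 1 n & k != n.+1./2].

Definition beta1 (n : nat) : seq rat :=
  1 / 2 :: [seq k%:R / n%:R | k <- iota 1 n.-1].

(* [iota 1 (2 * n - 3)] is 1, ..., 2n-3 and [iota 1 (n - 3)] is 1, ..., n-3. *)
Definition alpha2 (n : nat) : seq rat :=
  1 / 2 :: [seq k%:R / (2 * n - 2)%:R | k <- iota 1 (2 * n - 3) & odd k].

Definition beta2 (n : nat) : seq rat :=
  [:: 0; 0; 0] ++ [seq k%:R / (n - 2)%:R | k <- iota 1 (n - 3)].

(* Main.v *)
Require Import Defs.
From HB Require Import structures.
From mathcomp Require Import all_boot all_order all_algebra.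
From mathcomp Require Import all_classical all_reals all_analysis.
From mathcomp Require Import complex ring lra zify.

(** Write [A] and [B] for the two companion matrices.  They differ in their
    last column only, so [A^-1 B] fixes a hyperplane pointwise; in both
    families it is a reflection [C] in a spacelike vector [v], and [l = f(v, -)]
    is a multiple of the last coordinate.  The form [f] is unique up to a
    scalar ([invariant_form_unique]), so one invariant form of the right
    signature suffices.

    The reason for infinite index is that the orbit of [v] misses part of the
    light cone.  Suppose that [T] is a set of vectors, stable under the group,
    on which [l] does not vanish, and that for [g = A] and [g = B] the sign of
    [l(w) l(g w)] is the same for all [w] in [T].  This property passes to
    products and inverses, hence holds for every [g] in the group
    ([same_side], [generated_same_side]).  Geometrically, the vectors [g v],
    with suitable signs, lie on one side of the hyperplane orthogonal to [w],
    for every [w] in [T]: these hyperplanes are walls which the orbit does not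
    cross.  Now take an isotropic vector [e] and a spacelike [u] orthogonal to
    it.  The Eichler transvections along [e] and [u] give a one-parameter group
    [E_m] of isometries, integral for [m] in some multiple of Z.  If the index
    were finite, some [E_m] with [m <> 0] and all its powers would lie in the
    group; but for large [m] the sign of [l(w) l(E_m w)] is that of
    [- f(u, u) l(w) l(e) f(e, w)].  So it is enough to find two vectors of [T]
    at which [l(w) l(e) f(e, w)] has opposite signs ([thin_eichler]).

    There remains the choice of [T], [e] and [u].  The walls are vectors of
    a fixed norm, subject to congruences which the generators preserve.
    Reflecting by [C] changes the sign of [l].  To control [A] one uses a linear
    form [s] with [s(A w) = s(w)] or [s(A w) = - s(w)], and shows that the sign
    of [l(w) s(w)] is constant on [T], because the wrong sign would make the
    norm of [w] too large.  In the first family [s] is the sum of the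
    coordinates ([walls1_sign]).  In the second family a Krylov basis turns [A]
    into a change of sign of one timelike coordinate [t] together with a
    negacyclic permutation of the others, and [s = t] ([ell2_sign]); in rank 5
    the congruences modulo 8 need an explicit finite class of residues to keep
    [t] away from 0 ([state_class]). *)

Set Implicit Arguments.
Unset Strict Implicit.
Unset Printing Implicit Defensive.

Import Order.TTheory GRing.Theory Num.Theory.

Local Open Scope classical_set_scope.
Local Open Scope ring_scope.

Local Notation ratmx := (map_mx (intr : int -> rat)).

(** * Exponents and cyclotomic products *)

Section RootsOfUnity.
Variable R : realType.
Implicit Types (a b : rat) (k n : nat).
Local Notation cexp := (cexp2pi R).

Lemma cexp2piD a b : cexp (a + b) = cexp a * cexp b.
Proof.
rewrite /cexp2pi rmorphD mulrDr cosD sinD; simpc.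
by congr Complex; rewrite addrC.
Qed.

Lemma cexp2pi0 : cexp 0 = 1.
Proof. by rewrite /cexp2pi rmorph0 mulr0 cos0 sin0. Qed.

Lemma cexp2pi1 : cexp 1 = 1.
Proof. by rewrite /cexp2pi rmorph1 mulr1 mulr_natl cos2pi sin2pi. Qed.

Lemma cexp2pi_half : cexp (1 / 2) = -1.
Proof.
rewrite /cexp2pi fmorph_div rmorph1 rmorph_nat mulrA mulr1 mulrAC divff //.
by rewrite mul1r cospi sinpi; apply/eqP; rewrite eq_complex /= oppr0 !eqxx.
Qed.

Lemma cexp2piX k a : cexp (k%:R * a) = cexp a ^+ k.
Proof.
elim: k => [|k IHk]; first by rewrite mul0r cexp2pi0.
by rewrite -natr1 mulrDl mul1r cexp2piD IHk exprSr.
Qed.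

Lemma cexp2pi_neq1 a : 0 < a < 1 -> cexp a != 1.
Proof.
move=> /andP[a_gt0 a_lt1]; apply/eqP => /(congr1 (@complex.Re R)) /=.
set y : R := pi * ratr a.
have -> : 2 * pi * ratr a = y *+ 2 by rewrite -mulrA mulr_natl.
have y_in : 0 < y < pi.
  rewrite /y mulr_gt0 ?pi_gt0 ?ltr0q //=.
  by rewrite -[ltRHS]mulr1 ltr_pM2l ?pi_gt0 // -(rmorph1 (@ratr R)) ltr_rat.
rewrite cos_mulr2n => cos2y.
have := sin_gt0_pi y_in; have := cos2Dsin2 y; move=> cs s_gt0.
have : sin y ^+ 2 = 0 by rewrite mulr2n in cos2y; lra.
by move/eqP; rewrite sqrf_eq0 (gt_eqF s_gt0).
Qed.

(** No smaller power of [cexp (1 / n)] is 1, since [cexp] differs from 1 on the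
    open unit interval: it is a primitive root of unity. *)
Lemma prod_cexp2pi n : (0 < n)%N ->
  \prod_(0 <= k < n) ('X - (cexp (k%:R / n%:R))%:P) = 'X^n - 1.
Proof.
move=> n_gt0; have n_neq0 : n%:R != 0 :> rat by rewrite pnatr_eq0 -lt0n.
have prim_z : n.-primitive_root (cexp n%:R^-1).
  have zn1 : cexp n%:R^-1 ^+ n = 1 by rewrite -cexp2piX divff ?cexp2pi1.
  have [m prim_m m_dvd_n] := prim_order_exists n_gt0 zn1.
  case: (ltngtP m n) (dvdn_leq n_gt0 m_dvd_n) => // [m_lt_n|eq_mn] _; last first.
    by rewrite -[X in X.-primitive_root _]eq_mn.
  have := prim_expr_order prim_m; rewrite -cexp2piX => /eqP.
  rewrite (negPf (cexp2pi_neq1 _)) //.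
  rewrite divr_gt0 ?ltr0n ?(prim_order_gt0 prim_m) //=.
  by rewrite ltr_pdivrMr ?ltr0n // mul1r ltr_nat.
rewrite -(factor_Xn_sub_1 prim_z); apply: eq_bigr => k _.
by rewrite cexp2piX.
Qed.

Lemma exponent_poly_cons a s :
  exponent_poly R (a :: s) = ('X - (cexp a)%:P) * exponent_poly R s.
Proof. by rewrite /exponent_poly big_cons. Qed.

Lemma cexp2pi_half_factor : 'X - (cexp (1 / 2))%:P = 'X + 1.
Proof. by rewrite cexp2pi_half polyCN opprK. Qed.

(** The factor [X + 1] restores the exponent 1/2, the only multiple of
    1/(n+1) which the list leaves out. *)
Lemma exponent_poly_alpha1 n : odd n ->
  exponent_poly R (alpha1 n) * ('X + 1) = 'X^(n.+1) - 1.
Proof.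
move=> n_odd; rewrite -prod_cexp2pi // big_ltn // mul0r.
rewrite exponent_poly_cons -mulrA; congr (_ * _).
rewrite /exponent_poly big_map big_filter mulrC.
set h := n.+1./2; have n2 : n.+1 = (h * 2)%N.
  by rewrite muln2 -[LHS]odd_double_half /= n_odd.
have h_in : h \in index_iota 1 n.+1 by rewrite mem_index_iota; lia.
rewrite (bigD1_seq _ h_in) ?iota_uniq //=; congr (_ * _); last first.
  by rewrite /index_iota subSS subn0.
rewrite -cexp2pi_half_factor; congr ('X - (cexp _)%:P).
rewrite n2 natrM invfM mulrA divff ?mul1r //.
by rewrite pnatr_eq0; lia.
Qed.

Lemma exponent_poly_beta1 n : (0 < n)%N ->
  exponent_poly R (beta1 n) * ('X - 1) = ('X + 1) * ('X^n - 1).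
Proof.
move=> n_gt0; rewrite -prod_cexp2pi // big_ltn // mul0r cexp2pi0.
rewrite exponent_poly_cons cexp2pi_half_factor -mulrA; congr (_ * _).
by rewrite mulrC /exponent_poly big_map /index_iota subn1.
Qed.

Lemma prod_even_nat (S : comNzRingType) (G : nat -> S) n :
  \prod_(0 <= k < 2 * n | ~~ odd k) G k = \prod_(0 <= k < n) G (2 * k)%N.
Proof.
rewrite big_mkcond; elim: n => [|n IHn]; first by rewrite !big_geq.
rewrite mulnS addSn addSn add0n big_nat_recr //= big_nat_recr //= IHn.
by rewrite oddM /= mulr1 big_nat_recr.
Qed.

(** Among the multiples of 1/2N in [0, 1), N = n - 1, the even ones are the
    multiples of 1/N; dividing X^2N - 1 by X^N - 1 leaves X^N + 1. *)
Lemma exponent_poly_alpha2 n : (1 < n)%N ->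
  exponent_poly R (alpha2 n) = ('X + 1) * ('X^(n.-1) + 1).
Proof.
case: n => [|[|m]] // _; rewrite exponent_poly_cons cexp2pi_half_factor; congr (_ * _).
rewrite -[m.+2.-1]/(m.+1); set N := m.+1.
have N_gt0 : (0 < N)%N by [].
have nz : 'X^N - 1 != 0 :> {poly R[i]}.
  by rewrite -size_poly_gt0 size_XnsubC.
apply: (mulIf nz); rewrite [RHS]mulrC -subr_sqr_1 -exprM [(N * 2)%N]mulnC /exponent_poly big_map.
rewrite big_filter (_ : 2 * N.+1 - 2 = 2 * N)%N; last by lia.
rewrite -[RHS]prod_cexp2pi ?muln_gt0 // [RHS](bigID odd) /= prod_even_nat.
congr (_ * _).
  rewrite [RHS]big_mkcond [RHS]big_ltn ?muln_gt0 //= mul1r -[RHS]big_mkcond /=.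
  by rewrite /index_iota (_ : 2 * N.+1 - 3 = 2 * N - 1)%N //; lia.
rewrite -prod_cexp2pi //; apply: eq_bigr => k _.
rewrite !natrM invfM mulrACA divff ?mul1r //.
Qed.

Lemma exponent_poly_beta2 n : (2 < n)%N ->
  exponent_poly R (beta2 n) = ('X - 1) ^+ 2 * ('X^(n - 2) - 1).
Proof.
move=> n_gt2; rewrite /beta2 !exponent_poly_cons cexp2pi0 !mulrA -expr2 -mulrA.
congr (_ * _); rewrite -prod_cexp2pi; last by lia.
rewrite big_ltn; last by lia.
rewrite mul0r cexp2pi0; congr (_ * _).
by rewrite /exponent_poly big_map /index_iota (_ : n - 3 = n - 2 - 1)%N //; lia.
Qed.

End RootsOfUnity.

(** * Companion matrices and their common invariant form *)

Lemma map_companion (K L : nzRingType) (f : {rmorphism K -> L}) n (p : {poly K}) :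
  companion n (map_poly f p) = map_mx f (companion n p).
Proof.
apply/matrixP => i j; rewrite !mxE coef_map.
by case: eqP => _; rewrite ?rmorphN ?rmorph_nat.
Qed.

Section Companion.
Variables (F : fieldType) (n : nat).
Implicit Types (p q r : {poly F}) (A B G : 'M[F]_n.+1).

Local Notation last_col := (delta_mx ord_max 0 : 'cV[F]_n.+1).

Lemma companion_tr_delta p (i j : 'I_n.+1) : i = j.+1 :> nat ->
  (companion n.+1 p)^T *m delta_mx i (0 : 'I_1)
    = delta_mx j 0 - p`_i *: last_col.
Proof.
move=> ij; apply/matrixP => r c; rewrite (ord1 c) -colE !mxE eqxx !andbT.
have rmax : (r == ord_max) = (r == n :> nat) by [].
rewrite rmax; case: eqP => rn.
  have -> : (r == j) = false.
    by apply/negbTE/eqP => rj; have := ltn_ord i; rewrite ij -rj rn ltnn.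
  by rewrite mulr1 sub0r.
rewrite mulr0 subr0.
by rewrite ij eqSS eq_sym.
Qed.

Lemma companion_ind (P : 'I_n.+1 -> Prop) : P ord_max ->
  (forall i j : 'I_n.+1, i = j.+1 :> nat -> P i -> P j) -> forall i, P i.
Proof.
move=> Pmax Pstep.
suff H d (i : 'I_n.+1) : (d + i = n)%N -> P i.
  by move=> i; apply: (H (n - i)%N); have := ltn_ord i; lia.
elim: d i => [|d IHd] i din.
  by rewrite (_ : i = ord_max) //; apply: val_inj.
have i1 : (i.+1 < n.+1)%N by lia.
by apply: (Pstep (Ordinal i1)) => //; apply: IHd => /=; lia.
Qed.

(** The last basis vector generates the module of the transposed companion
    matrix, so an intertwiner that kills it is zero. *)
Lemma companion_cyclic p m (K : 'M[F]_(m, n.+1)) (B : 'M[F]_m) :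
  K *m (companion n.+1 p)^T = B *m K -> K *m last_col = 0 -> K = 0.
Proof.
move=> KA Kmax.
have Kd i : K *m delta_mx i (0 : 'I_1) = 0.
  elim/companion_ind: i => // i j ij Ki.
  have := congr1 (mulmx K) (companion_tr_delta p ij).
  rewrite mulmxA KA -mulmxA Ki mulmx0 mulmxBr -scalemxAr Kmax scaler0 subr0.
  by move=> <-.
apply/matrixP => i j; have /matrixP/(_ i 0) := Kd j.
by rewrite -colE !mxE.
Qed.

Definition coef_col r : 'cV[F]_n.+1 := \col_i r`_i.

Lemma companion_rank1 p q : companion n.+1 q =
  companion n.+1 p + coef_col (p - q) *m last_col^T.
Proof.
apply/matrixP => i j; rewrite trmx_delta !mxE big_ord1 !mxE coefB /=.
rewrite (_ : (j == ord_max) = (j == n :> nat)) //.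
by case: eqP => _; rewrite ?mulr0 ?addr0 // mulr1 addrA addNr sub0r.
Qed.

(** Expanding the second isometry relation leaves [a d^T + d a^T + c d d^T = 0]
    for [a = A G e] and a scalar [c], which forces [a] to be proportional to
    [d]. *)
Lemma rank1_isometry A G (d e : 'cV[F]_n.+1) : G^T = G -> d != 0 ->
  A *m G *m A^T = G -> (A + d *m e^T) *m G *m (A + d *m e^T)^T = G ->
  exists k, A *m G *m e = k *: d.
Proof.
move=> Gsym d_neq0 AG; rewrite linearD /= trmx_mul trmxK mulmxDr !mulmxDl AG.
rewrite -[RHS]addr0 -addrA => /addrI; set a := A *m G *m e => eq0.
have daT : d *m e^T *m G *m A^T = d *m a^T.
  by rewrite /a !trmx_mul Gsym !mulmxA.
have {eq0 daT} eqij i j :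
    a i 0 * d j 0 + d i 0 * a j 0 + d i 0 * (e^T *m G *m e) 0 0 * d j 0 = 0.
  move/matrixP/(_ i j): eq0; rewrite daT addrA [X in X + _]addrC.
  rewrite [A *m G *m (e *m d^T)]mulmxA -/a.
  rewrite [d *m e^T *m G *m (e *m d^T)](_ : _ = d *m (e^T *m G *m e) *m d^T);
    last by rewrite !mulmxA.
  by rewrite !mxE !big_ord1 !mxE !big_ord1 !mxE.
have [i di] : exists i, d i 0 != 0.
  apply/existsP; apply: contraNT d_neq0; rewrite negb_exists => /forallP d0.
  apply/eqP/matrixP => i j; rewrite (ord1 j) mxE; apply/eqP.
  by have := d0 i; rewrite negbK.
exists (- (a i 0 / d i 0 + (e^T *m G *m e) 0 0)).
apply/matrixP => j k; rewrite (ord1 k) [RHS]mxE; apply: (mulfI di).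
have := eqij i j; set g := (e^T *m G *m e) 0 0.
move: (a i 0) (a j 0) (d j 0) di; set s := d i 0 => x y z s_neq0 H.
have -> : s * y = - (x * z) - s * g * z.
  by apply/eqP; rewrite -subr_eq0 -H; apply/eqP; ring.
by field.
Qed.

Lemma invmx_isometry A G : G \in unitmx -> A^T *m G *m A = G ->
  A \in unitmx /\ A *m invmx G *m A^T = invmx G.
Proof.
move=> Gu AG; have inv : (invmx G *m A^T *m G) *m A = 1%:M.
  by rewrite -!mulmxA mulmxA -mulmxA [A^T *m _]mulmxA AG mulVmx.
have [_ Au] := mulmx1_unit inv; split=> //.
by have := mulmx1C inv; rewrite !mulmxA => /(canRL (mulmxK Gu)); rewrite mul1mx.
Qed.

(** For both inverse Gram matrices V, the vector [A V e] is a multiple of the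
    column [d] by which the two companion matrices differ.  Hence a combination
    of the two inverses kills the last basis vector [e]; it intertwines [A^T]
    with [A^-1], so it vanishes. *)
Lemma invariant_form_unique p q G1 G2 :
  companion n.+1 p != companion n.+1 q ->
  (forall G, (G = G1) \/ (G = G2) -> [/\ G^T = G, G \in unitmx,
     (companion n.+1 p)^T *m G *m companion n.+1 p = G &
     (companion n.+1 q)^T *m G *m companion n.+1 q = G]) ->
  exists2 k, k != 0 & G2 = k *: G1.
Proof.
set A := companion n.+1 p; set B := companion n.+1 q => AB HG.
set d := coef_col (p - q); set e := last_col.
have BE : B = A + d *m e^T by apply: companion_rank1.
have d_neq0 : d != 0.
  by apply: contraNneq AB => d0; rewrite BE d0 mul0mx addr0.
have e_neq0 : e != 0.
  apply/eqP => /matrixP/(_ ord_max 0); rewrite !mxE !eqxx /= => /eqP.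
  by rewrite oner_eq0.
have step G : (G = G1) \/ (G = G2) -> [/\ A \in unitmx,
    A *m invmx G *m A^T = invmx G & exists2 k, k != 0 & A *m invmx G *m e = k *: d].
  move=> /HG[Gsym Gu AG BG].
  have [Au AV] := invmx_isometry Gu AG.
  have [_ BV] := invmx_isometry Gu BG.
  have Vsym : (invmx G)^T = invmx G by rewrite trmx_inv Gsym.
  rewrite BE in BV; have [k kE] := rank1_isometry Vsym d_neq0 AV BV.
  split=> //; exists k => //; apply: contraNneq e_neq0 => k0.
  rewrite -[e](mulKmx (_ : invmx G \in unitmx)) ?unitmx_inv //.
  by rewrite -[invmx G *m e](mulKmx Au) [A *m (_ *m e)]mulmxA kE k0 scale0r !mulmx0.
have [Au V1 [k1 k1_neq0 E1]] := step G1 (or_introl erefl).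
have [_ V2 [k2 k2_neq0 E2]] := step G2 (or_intror erefl).
have [_ G1u _ _] := HG G1 (or_introl erefl).
have [_ G2u _ _] := HG G2 (or_intror erefl).
have K0 : k1 *: invmx G2 - k2 *: invmx G1 = 0.
  apply: (@companion_cyclic p _ _ (invmx A)); rewrite -/A.
    apply: (can_inj (mulKmx Au)); rewrite mulKVmx // mulmxA mulmxBr mulmxBl.
    by rewrite -!scalemxAr -!scalemxAl V1 V2.
  apply: (can_inj (mulKmx Au)); rewrite mulmx0 mulmxA mulmxBr mulmxBl.
  by rewrite -!scalemxAr -!scalemxAl E1 E2 !scalerA mulrC subrr.
have VE : invmx G2 = (k2 / k1) *: invmx G1.
  apply: (scalerI k1_neq0); rewrite scalerA mulrCA divff // mulr1.
  by apply/eqP; rewrite -subr_eq0 K0.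
exists (k1 / k2); first by rewrite mulf_neq0 ?invr_eq0.
rewrite -[G2]invmxK VE invmxZ ?unitmx_inv //; last first.
  by rewrite unitmxZ ?unitmx_inv // unitfE mulf_neq0 ?invr_eq0.
by rewrite invmxK invf_div.
Qed.

(** A cyclic vector [c] of [A] yields a basis in which [A] becomes a companion
    matrix; this recovers the integral matrices from a model in convenient
    rational coordinates. *)
Section Krylov.
Variables (A : 'M[F]_n.+1) (c : 'cV[F]_n.+1).

Definition krylov : 'M[F]_n.+1 := \matrix_(i, j) (A ^+ j *m c) i 0.

Lemma col_krylov j : col j krylov = A ^+ j *m c.
Proof. by apply/colP => i; rewrite !mxE. Qed.

Lemma krylov_poly r : (size r <= n.+1)%N ->
  krylov *m coef_col r = horner_mx A r *m c.
Proof.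
move=> szr; have rE : r = \sum_(i < n.+1) r`_i *: 'X^i.
  rewrite -(poly_def _ (nth 0 r)); apply/polyP => i; rewrite coef_poly.
  by case: ltnP => // ni; rewrite nth_default // (leq_trans szr).
rewrite [in RHS]rE rmorph_sum /= mulmx_suml.
apply/matrixP => i j; rewrite (ord1 j) !mxE summxE; apply: eq_bigr => k _.
by rewrite linearZ /= rmorphXn /= horner_mx_X -scalemxAl !mxE mulrC.
Qed.

Lemma krylov_companion p : p \is monic -> size p = n.+2 ->
  horner_mx A p *m c = 0 -> krylov *m companion n.+1 p = A *m krylov.
Proof.
move=> p_monic szp pc0.
have szr : (size ('X^(n.+1) - p)%R <= n.+1)%N.
  apply/leq_sizeP => j; rewrite leq_eqVlt => /predU1P[<-|nj].
    by rewrite coefB coefXn eqxx -[n.+1]/(n.+2.-1) -szp -lead_coefE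
       (monicP p_monic) subrr.
  by rewrite coefB coefXn gtn_eqF // nth_default ?subrr // szp.
apply: trmx_inj; apply/row_matrixP => j; rewrite -!tr_col; congr trmx.
rewrite !colE -!mulmxA -!colE col_krylov mulmxA mulmxE -exprS.
case: (ltnP j n) => jn.
  have j1 : (j.+1 < n.+1)%N by [].
  have -> : col j (companion n.+1 p) = delta_mx (Ordinal j1) 0.
    apply/colP => i; rewrite !mxE eqxx andbT ltn_eqF //.
  by rewrite -colE col_krylov.
have jE : j = n :> nat by have := ltn_ord j; lia.
have -> : col j (companion n.+1 p) = coef_col ('X^(n.+1) - p).
  apply/colP => i; rewrite !mxE jE eqxx coefB coefXn.
  by rewrite ltn_eqF ?ltn_ord // sub0r.
by rewrite krylov_poly // rmorphB /= rmorphXn /= horner_mx_X mulmxBl pc0 subr0 jE.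
Qed.

(** The row space is stable under the companion matrix on the right, and
    contains the last basis row, from which the companion matrix produces all
    the others. *)
Lemma krylov_unit p (l : 'rV[F]_n.+1) :
  krylov *m companion n.+1 p = A *m krylov -> l *m krylov = last_col^T ->
  krylov \in unitmx.
Proof.
move=> kA lk; rewrite -row_full_unit -sub1mx; apply/row_subP => i.
rewrite rowE mulmx1.
elim/companion_ind: i => [|i j ij Ki].
  by rewrite -[delta_mx _ _]trmx_delta -lk submxMl.
have := congr1 trmx (companion_tr_delta p ij).
rewrite trmx_mul trmxK linearB /= linearZ /= !trmx_delta => E.
have -> : delta_mx 0 j = delta_mx 0 i *m companion n.+1 p + p`_i *: delta_mx 0 ord_max
            :> 'rV[F]_n.+1 by rewrite E subrK.
rewrite addmx_sub //.
  apply: submx_trans (submxMr _ Ki) _; rewrite kA; exact: submxMl.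
by rewrite scalemx_sub // -[delta_mx _ _]trmx_delta -lk submxMl.
Qed.

(** In the Krylov basis, the column by which the two companion matrices differ
    is [(p - q)(A) c], that is [A v]. *)
Lemma krylov_companion_rank1 p q (v : 'cV[F]_n.+1) (l : 'rV[F]_n.+1) :
    p \is monic -> q \is monic -> size p = n.+2 -> size q = n.+2 ->
    krylov *m companion n.+1 p = A *m krylov -> horner_mx A p *m c = 0 ->
    l *m krylov = last_col^T -> horner_mx A q *m c = - (A *m v) ->
  krylov *m companion n.+1 q = A *m (1%:M + v *m l) *m krylov.
Proof.
move=> p_monic q_monic szp szq kA pc0 lk qc.
have szpq : (size (p - q)%R <= n.+1)%N.
  apply/leq_sizeP => j; rewrite leq_eqVlt => /predU1P[<-|nj].
    rewrite coefB -{1}[n.+1]/(n.+2.-1) -{1}szp -[n.+1]/(n.+2.-1) -szq.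
    by rewrite -!lead_coefE (monicP p_monic) (monicP q_monic) subrr.
  by rewrite coefB !nth_default ?subrr // ?szp ?szq.
rewrite (companion_rank1 p q) [LHS]mulmxDr kA [krylov *m _]mulmxA krylov_poly //.
rewrite rmorphB /= mulmxBl.
by rewrite pc0 qc sub0r opprK mulmxDr mulmx1 mulmxDl -!mulmxA lk.
Qed.

End Krylov.
End Companion.

(** * Forms of signature (n, 1) *)

(** Keeping the first basis vector fixed makes it possible to start the
    diagonalization from a chosen vector in [lorentz_signature]. *)
Lemma schur_step n (G : 'M[rat]_(1 + n)) : G^T = G -> G 0 0 != 0 ->
  exists S (G' : 'M[rat]_n), [/\ S \in unitmx, G'^T = G',
    S^T *m G *m S = block_mx (G 0 0)%:M 0 0 G' & S *m delta_mx 0 0 = delta_mx 0 (0 : 'I_1)].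
Proof.
move=> Gsym a_neq0; set a := G 0 0 in a_neq0 *.
pose b := ursubmx G; pose g := drsubmx G.
have bT : dlsubmx G = b^T by rewrite /b trmx_ursub Gsym.
have aE : ulsubmx G = a%:M.
  by rewrite [LHS]mx11_scalar !mxE; congr (G _ _)%:M; apply: val_inj.
have gT : g^T = g by rewrite /g trmx_drsub Gsym.
exists (block_mx 1%:M (- a^-1 *: b) 0 1%:M), (g - a^-1 *: (b^T *m b)).
split.
- by rewrite unitmxE det_ublock !det1 mulr1 unitr1.
- by rewrite linearB /= linearZ /= trmx_mul trmxK gT.
- rewrite -[G]submxK aE bT -/b -/g tr_block_mx !trmx1 trmx0 linearZ /=.
  rewrite !mulmx_block !mul1mx !mul0mx !mulmx1 !mulmx0 !addr0.
  congr block_mx.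
  + by rewrite mul_scalar_mx scalerA mulrN divff // scaleN1r addNr.
  + by rewrite mul_mx_scalar scalerA mulrN divff // scaleN1r addNr.
  + rewrite mul_mx_scalar scalerA mulrN divff // scaleN1r addNr mul0mx add0r.
    by rewrite -scalemxAl scaleNr addrC.
- have -> : delta_mx 0 0 = col_mx 1%:M 0 :> 'cV[rat]_(1 + n).
    apply/matrixP => i j; rewrite (ord1 j) !mxE eqxx andbT.
    case: splitP => k ik; rewrite !mxE ?(ord1 k) ?eqxx.
      by rewrite (_ : i == 0) //; apply/eqP/val_inj; rewrite /= ik (ord1 k).
    by rewrite (_ : (i == 0) = false) //; apply/negbTE/eqP => i0; move: ik; rewrite i0.
  by rewrite mul_block_col !mul1mx !mulmx0 mul0mx !addr0.
Qed.

Lemma quadform_mul n m (G : 'M[rat]_n) (S : 'M[rat]_(n, m)) x :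
  quadform (S^T *m G *m S) x = (((S *m x)^T *m G) *m (S *m x)) 0 0.
Proof. by rewrite /quadform trmx_mul !mulmxA. Qed.

Lemma quadform_delta n (G : 'M[rat]_n) i : quadform G (delta_mx i 0) = G i i.
Proof. by rewrite /quadform trmx_delta -rowE -colE !mxE. Qed.

Lemma quadform_block n (G S : 'M[rat]_(1 + n)) (G' : 'M[rat]_n) a (y : 'cV_n) :
  S^T *m G *m S = block_mx a%:M 0 0 G' ->
  quadform G (S *m col_mx 0 y) = quadform G' y.
Proof.
move=> E; rewrite /quadform trmx_mul !mulmxA -[_ *m S^T *m G]mulmxA.
rewrite -[_ *m (S^T *m G) *m S]mulmxA E -mulmxA mul_block_col tr_col_mx.
by rewrite mul_row_col !mulmx0 !mul0mx !add0r trmx0 mul0mx add0r mulmxA.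
Qed.

Lemma block_diag n a (G S : 'M[rat]_n) (d : 'rV_n) : S^T *m G *m S = diag_mx d ->
  let B := block_mx 1%:M 0 0 S : 'M[rat]_(1 + n) in
  B^T *m block_mx a%:M 0 0 G *m B = diag_mx (row_mx a%:M d).
Proof.
move=> E /=; rewrite tr_block_mx !mulmx_block !trmx0 trmx1 !mulmx0 !mul0mx.
rewrite !mulmx1 !mul1mx !addr0 !add0r E diag_mx_row.
by congr block_mx; apply/matrixP => i j; rewrite ?mul0mx ?mulmx0 !mxE ?ord1.
Qed.

Lemma posdef_diag n (G : 'M[rat]_n) : G^T = G ->
    (forall x, x != 0 -> 0 < quadform G x) ->
  exists S d, [/\ S \in unitmx, S^T *m G *m S = diag_mx d & forall i, 0 < d 0 i].
Proof.
elim: n G => [|n IHn] G Gsym Gpos.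
  by exists 1%:M, 0; split=> [||[]//]; [exact: unitmx1 | apply/matrixP => -[]].
have G00 : 0 < G 0 0.
  rewrite -quadform_delta; apply: Gpos; apply/eqP => /matrixP/(_ 0 0).
  by rewrite !mxE !eqxx /= => /eqP; rewrite oner_eq0.
have [S1 [G' [S1u G'sym E S1d]]] := schur_step Gsym (lt0r_neq0 G00).
have [|S' [d' [S'u E' d'pos]]] := IHn G' G'sym.
  move=> y y_neq0; rewrite -(quadform_block y E); apply: Gpos.
  apply: contraNneq y_neq0 => /(congr1 (mulmx (invmx S1))).
  by rewrite mulKmx // mulmx0 -(col_mx0 rat 1 n 1) => /eq_col_mx[_ ->].
have Bu : (block_mx 1%:M 0 0 S' : 'M[rat]_(1 + n)) \in unitmx.
  by rewrite unitmxE det_ublock det1 mul1r -unitmxE.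
exists (S1 *m block_mx 1%:M 0 0 S'), (row_mx (G 0 0)%:M d'); split.
- by rewrite unitmx_mul S1u Bu.
- rewrite trmx_mul !mulmxA -[_ *m S1^T *m G]mulmxA -[_ *m (S1^T *m G) *m S1]mulmxA E.
  exact: block_diag E'.
- move=> i; rewrite mxE; case: splitP => k _; last exact: d'pos.
  by rewrite (ord1 k) mxE eqxx.
Qed.

(** The orthogonal complement of a timelike vector splits off and is positive
    definite, hence can be diagonalized with positive entries. *)
Lemma lorentz_signature n (F S : 'M[rat]_(1 + n)) : F^T = F -> S \in unitmx ->
    quadform F (S *m delta_mx 0 0) < 0 ->
    (forall x, x != 0 -> (S *m delta_mx 0 0)^T *m F *m x = 0 :> 'M[rat]_1 ->
       0 < quadform F x) ->
  has_signature F n 1.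
Proof.
move=> Fsym Su v_neg v_pos; have [G GE] : exists G, S^T *m F *m S = G by exists (S^T *m F *m S).
have Gsym : G^T = G by rewrite -GE !trmx_mul trmxK Fsym mulmxA.
have G00 : G 0 0 < 0.
  by rewrite -quadform_delta -GE quadform_mul; apply: le_lt_trans v_neg.
have [S1 [G' [S1u G'sym E S1d]]] := schur_step Gsym (ltr0_neq0 G00).
have [|S' [d' [S'u E' d'pos]]] := posdef_diag G'sym.
  move=> y y_neq0; rewrite -(quadform_block y E) -GE quadform_mul.
  apply: v_pos.
    apply: contraNneq y_neq0 => /(congr1 (mulmx (invmx S))).
    rewrite mulKmx // mulmx0 => /(congr1 (mulmx (invmx S1))).
    by rewrite mulKmx // mulmx0 -(col_mx0 rat 1 n 1) => /eq_col_mx[_ ->].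
  rewrite trmx_mul -S1d trmx_mul !mulmxA.
  rewrite -[_ *m S^T *m F]mulmxA -[_ *m (S^T *m F) *m S]mulmxA GE.
  rewrite -[_ *m S1^T *m G]mulmxA -[_ *m (S1^T *m G) *m S1]mulmxA E.
  rewrite -mulmxA mul_block_col !mulmx0 mul0mx !add0r.
  apply/matrixP => i j; rewrite (ord1 i) trmx_delta -rowE !mxE.
  by case: splitP => k //; rewrite (ord1 k) mxE.
exists (S *m (S1 *m block_mx 1%:M 0 0 S')), (row_mx (G 0 0)%:M d').
have dE (i : 'I_(1 + n)) : (row_mx (G 0 0)%:M d' : 'rV_(1 + n)) 0 i < 0 = (i == 0)
    /\ 0 < (row_mx (G 0 0)%:M d' : 'rV_(1 + n)) 0 i = (i != 0).
  rewrite mxE; case: splitP => k ik.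
    have -> : i = 0 by apply: val_inj; rewrite /= ik (ord1 k).
    by rewrite (ord1 k) mxE !eqxx mulr1n G00 [0 < _]lt_gtF.
  have -> : (i == 0) = false by apply/negbTE/eqP => i0; move: ik; rewrite i0.
  by rewrite d'pos lt_gtF.
have Bu : (block_mx 1%:M 0 0 S' : 'M[rat]_(1 + n)) \in unitmx.
  by rewrite unitmxE det_ublock det1 mul1r -unitmxE.
split.
- by rewrite unitmx_mul Su unitmx_mul S1u Bu.
- rewrite trmx_mul !mulmxA -[_ *m S^T *m F]mulmxA -[_ *m (S^T *m F) *m S]mulmxA GE.
  rewrite trmx_mul ?mulmxA -[_ *m S1^T *m G]mulmxA -[_ *m (S1^T *m G) *m S1]mulmxA E.
  exact: block_diag E'.
- have -> : [set i | 0 < (row_mx (G 0 0)%:M d' : 'rV_(1 + n)) 0 i]%SET = [set~ 0]%SET.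
    by apply/setP => i; rewrite !inE; have [_ ->] := dE i.
  by rewrite cardsC1 card_ord.
- have -> : [set i | (row_mx (G 0 0)%:M d' : 'rV_(1 + n)) 0 i < 0]%SET = [set 0]%SET.
    by apply/setP => i; rewrite !inE; have [-> _] := dE i.
  by rewrite cards1.
Qed.

(** * The half-space criterion for infinite index *)

Lemma symmetric_quadform_eq0 n (K : 'M[rat]_n) : K^T = K ->
  (forall x, quadform K x = 0) -> K = 0.
Proof.
move=> Ksym K0; apply/matrixP => i j; rewrite [RHS]mxE.
have : quadform K (delta_mx i 0 + delta_mx j 0) = K i i + K i j + (K j i + K j j).
  rewrite /quadform [X in X *m K]linearD /= !trmx_delta !mulmxDl !mulmxDr -!rowE.
  by rewrite -!colE !mxE.
have -> : K j i = K i j by rewrite -[in LHS]Ksym mxE.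
rewrite K0 -!(quadform_delta K) !K0; lra.
Qed.

Lemma isometry_of_quadform n (F g : 'M[rat]_n) : F^T = F ->
  (forall x, quadform F (g *m x) = quadform F x) -> g^T *m F *m g = F.
Proof.
move=> Fsym gF; apply/eqP; rewrite -subr_eq0; apply/eqP.
apply: symmetric_quadform_eq0 => [|x].
  by rewrite linearB /= !trmx_mul trmxK Fsym mulmxA.
have : quadform (g^T *m F *m g) x = quadform F x.
  by rewrite quadform_mul; apply: gF.
rewrite /quadform mulmxBr mulmxBl => E.
by rewrite [LHS]mxE E [X in _ + X]mxE subrr.
Qed.

Lemma map_int_mx_inj (K : numDomainType) m n :
  injective (map_mx (intr : int -> K) : 'M[int]_(m, n) -> 'M[K]_(m, n)).
Proof.
move=> X Y /matrixP XY; apply/matrixP => i j; have := XY i j; rewrite !mxE.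
exact: intr_inj.
Qed.

Lemma map_int_unitmx (K : comUnitRingType) n (g : 'M[int]_n) : g \in unitmx ->
  map_mx intr g \in (unitmx : {pred 'M[K]_n}).
Proof.
move=> gu; apply: (@mulmx1_unit _ _ (map_mx intr (invmx g)) _ _).2.
by rewrite -map_mxM mulVmx // map_mx1.
Qed.

Lemma invmx_map_int (K : comUnitRingType) n (g : 'M[int]_n) : g \in unitmx ->
  invmx (map_mx intr g) = map_mx intr (invmx g) :> 'M[K]_n.
Proof.
move=> gu; have E : map_mx intr (invmx g) *m map_mx intr g = 1%:M :> 'M[K]_n.
  by rewrite -map_mxM mulVmx // map_mx1.
by rewrite -[RHS]mulmx1 -(mulmxV (map_int_unitmx K gu)) mulmxA E mul1mx.
Qed.

Lemma generated_int_ind (K : comUnitRingType) n (A B : 'M[int]_n)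
    (P : 'M[int]_n -> Prop) :
    A \in unitmx -> B \in unitmx -> P A -> P B -> P 1%:M ->
    (forall g h, P g -> P h -> P (g *m h)) ->
    (forall g, g \in unitmx -> P g -> P (invmx g)) ->
  forall h : 'M[K]_n,
    generated [set (map_mx intr A : 'M[K]_n); (map_mx intr B : 'M[K]_n)] h ->
  exists g, [/\ g \in unitmx, P g & h = map_mx intr g].
Proof.
move=> Au Bu PA PB P1 PM PV h; elim=> {h} [h [->|->]||g h _ [g' [g'u Pg ->]] _ [h' [h'u Ph ->]]|g _ [g' [g'u Pg ->]]].
- by exists A.
- by exists B.
- by exists 1%:M; rewrite unitmx1 map_mx1.
- by exists (g' *m h'); split; [rewrite unitmx_mul g'u | exact: PM | rewrite map_mxM].
- by exists (invmx g'); split; [rewrite unitmx_inv | exact: PV | exact: invmx_map_int].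
Qed.

Lemma common_denominator m n (N : 'M[rat]_(m, n)) :
  exists (d : int) (X : 'M[int]_(m, n)), d != 0 /\ ratmx X = d%:~R *: N.
Proof.
pose d : int := \prod_(k : 'I_m * 'I_n) denq (N k.1 k.2).
exists d, (\matrix_(i, j) (numq (N i j) *
   \prod_(k : 'I_m * 'I_n | k != (i, j)) denq (N k.1 k.2))); split.
  by apply/prodf_neq0 => k _; rewrite denq_neq0.
apply/matrixP => i j; rewrite !mxE /d [in RHS](bigD1 (i, j)) //= !rmorphM /=.
rewrite mulrAC; congr (_ * _).
by rewrite numqE mulrC.
Qed.

Section HalfSpace.
Variables (n : nat) (T : 'cV[rat]_n -> Prop) (l : 'rV[rat]_n).

Local Notation lv w := ((l *m w) 0 0).

(** The sign of [l(w) l(g w)] is the same for all [w] in [T]; multiplying the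
    values at two vectors avoids naming that sign.  When [l = f(v, -)], this
    means that [g^-1 v], up to one sign, lies on the same side as [v] of every
    hyperplane orthogonal to a vector of [T]. *)
Definition same_side (g : 'M[rat]_n) : Prop :=
  (forall w, T (g *m w) <-> T w) /\
  (forall w w', T w -> T w' ->
     0 < (lv w * (lv (g *m w))) * (lv w' * (lv (g *m w')))).

Hypothesis l_neq0 : forall w, T w -> lv w != 0.

Lemma same_side1 : same_side 1%:M.
Proof.
split=> [w|w w' Tw Tw']; rewrite !mul1mx // -!expr2.
by rewrite mulr_gt0 // exprn_even_gt0 //= l_neq0.
Qed.

Lemma same_sideM g h : same_side g -> same_side h -> same_side (g *m h).
Proof.
move=> [gT gl] [hT hl]; split=> [w|w w' Tw Tw']; first by rewrite -mulmxA gT hT.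
have Tgw := (hT w).2 Tw; have Tgw' := (hT w').2 Tw'.
have := mulr_gt0 (gl _ _ Tgw Tgw') (hl _ _ Tw Tw').
rewrite -!mulmxA.
set a := lv w; set b := lv (h *m w); set c := lv (g *m (h *m w)).
set a' := lv w'; set b' := lv (h *m w'); set c' := lv (g *m (h *m w')).
have -> : b * c * (b' * c') * (a * b * (a' * b')) = (b * b') ^+ 2 * (a * c * (a' * c')).
  by ring.
by rewrite pmulr_rgt0 // exprn_even_gt0 //= mulf_neq0 ?l_neq0.
Qed.

Lemma same_sideV g : g \in unitmx -> same_side g -> same_side (invmx g).
Proof.
move=> gu [gT gl]; have VT w : T (invmx g *m w) <-> T w by rewrite -gT mulKVmx.
split=> // w w' Tw Tw'; have := gl _ _ ((VT w).2 Tw) ((VT w').2 Tw').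
by rewrite !mulKVmx // [X in X * _]mulrC [X in _ * X]mulrC.
Qed.

End HalfSpace.

Lemma quadratic_eventually_gt0 (a b c : rat) : 0 < a ->
  exists M : nat, forall m : nat, (M <= m)%N -> 0 < c + m%:R * b + m%:R ^+ 2 * a.
Proof.
move=> a_gt0; pose M := Num.bound ((`|b| + `|c|) / a).
exists M.+1 => m Mm; have m_ge1 : 1 <= m%:R :> rat by rewrite ler1n; lia.
have : (`|b| + `|c|) / a < m%:R.
  apply: lt_le_trans (archi_boundP _) _; last by rewrite ler_nat; lia.
  by rewrite divr_ge0 ?addr_ge0 // ltW.
rewrite ltr_pdivrMr // => H.
have Hb := ler_norm (- b); have Hc := ler_norm (- c); rewrite !normrN in Hb Hc.
have : m%:R * (`|b| + `|c|) < m%:R * (m%:R * a) by rewrite ltr_pM2l //; lra.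
have : m%:R * - b <= m%:R * `|b| by rewrite ler_pM2l //; lra.
have : 1 * `|c| <= m%:R * `|c| by rewrite ler_wpM2r.
rewrite expr2 -mulrA; lra.
Qed.

Section Criterion.
Variables (R : realType) (n : nat) (A B : 'M[int]_n) (F : 'M[rat]_n).
Variables (T : 'cV[rat]_n -> Prop) (l : 'rV[rat]_n).

Local Notation lv w := ((l *m w) 0 0).
Local Notation C := (R[i]).
Local Notation cmx := (map_mx (intr : int -> C)).

Hypothesis l_neq0 : forall w, T w -> lv w != 0.
Hypothesis (Au : A \in unitmx) (Bu : B \in unitmx).
Hypothesis (A_side : same_side T l (ratmx A)) (B_side : same_side T l (ratmx B)).

Lemma generated_same_side h :
  generated [set cmx A; cmx B] h ->
  exists g, [/\ g \in unitmx, same_side T l (ratmx g) & h = cmx g].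
Proof.
apply: (@generated_int_ind _ _ A B (fun g => same_side T l (ratmx g))) => //.
- by rewrite map_mx1; apply: same_side1.
- by move=> g g' Sg Sg'; rewrite map_mxM; apply: same_sideM.
- move=> g gu Sg; rewrite -invmx_map_int //; apply: same_sideV Sg.
  exact: map_int_unitmx.
Qed.

Variables (N : 'M[rat]_n) (w1 w2 : 'cV[rat]_n).
Hypothesis NF : N^T *m F = - (F *m N).
Hypothesis N3 : N *m N *m N = 0.
Hypothesis (Tw1 : T w1) (Tw2 : T w2).
Hypothesis w1_lt0 : lv w1 * lv (N *m N *m w1) < 0.
Hypothesis w2_gt0 : 0 < lv w2 * lv (N *m N *m w2).

(** The exponential of [2 k X] when [X^3 = 0]; the factor 2 makes the quadratic
    term integral. *)
Definition transvection (X : 'M[int]_n) (k : int) : 'M[int]_n :=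
  1%:M + (2 * k) *: X + (2 * k ^+ 2) *: (X *m X).

Lemma transvectionD X j k : X *m X *m X = 0 ->
  transvection X j *m transvection X k = transvection X (j + k).
Proof.
move=> X3; have X3' : X *m (X *m X) = 0 by rewrite mulmxA.
have X4 : X *m X *m (X *m X) = 0 by rewrite mulmxA X3 mul0mx.
rewrite /transvection !mulmxDl !mulmxDr !mul1mx !mulmx1 -!scalemxAl -!scalemxAr.
rewrite X3 X3' X4 !scaler0 !addr0 !scalerA.
move: (X *m X) => Y; apply/matrixP => a b; rewrite !mxE; ring.
Qed.

Lemma transvection0 X : transvection X 0 = 1%:M.
Proof. by rewrite /transvection expr2 !mulr0 !scale0r !addr0. Qed.

Lemma transvection_unit X k : X *m X *m X = 0 -> transvection X k \in unitmx.
Proof.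
move=> X3; apply: (@mulmx1_unit _ _ _ (transvection X (- k)) _).1.
by rewrite transvectionD // subrr transvection0.
Qed.

Lemma ratmx_transvection X k : ratmx (transvection X k) =
  1%:M + (2 * k)%:~R *: ratmx X + (2 * k ^+ 2)%:~R *: (ratmx X *m ratmx X).
Proof. by rewrite /transvection !map_mxD !map_mxZ map_mxM map_mx1. Qed.

Lemma transvection_isometry X k : X *m X *m X = 0 ->
    (ratmx X)^T *m F = - (F *m ratmx X) ->
  (ratmx (transvection X k))^T *m F *m ratmx (transvection X k) = F.
Proof.
move=> X3 XF.
have TF : (ratmx (transvection X k))^T *m F = F *m ratmx (transvection X (- k)).
  rewrite !ratmx_transvection !linearD /= !linearZ /= trmx1 trmx_mul.
  rewrite !mulmxDl mul1mx mulmx1 -!scalemxAl XF.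
  rewrite -[_ *m _ *m F]mulmxA XF mulmxN mulmxA XF mulNmx opprK -mulmxA.
  by rewrite sqrrN mulrN rmorphN scalerN scaleNr.
by rewrite TF -mulmxA -map_mxM transvectionD // addNr transvection0 map_mx1 mulmx1.
Qed.

(** If the index were finite, two of the transvections would lie in the same
    coset, so that some [exp(2 k X)] with [k <> 0], and all its powers, would lie
    in the group.  Along these powers [l(w) l(g w)] is a quadratic polynomial in
    the exponent, whose leading coefficient has opposite signs at [w1] and
    [w2]. *)
Lemma infinite_index_half_space :
  infinite_index (generated [set cmx A; cmx B]) (integral_orthogonal_group R F).
Proof.
have [d [X [d_neq0 XE]]] := common_denominator N.
have dq_neq0 : d%:~R != 0 :> rat by rewrite intr_eq0.
have X3 : X *m X *m X = 0.
  apply: (@map_int_mx_inj rat); rewrite map_mx0 !map_mxM XE.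
  by rewrite -!scalemxAl -!scalemxAr -!scalemxAl N3 !scaler0.
have XF : (ratmx X)^T *m F = - (F *m ratmx X).
  by rewrite XE linearZ /= -scalemxAl -scalemxAr NF scalerN.
set H := generated _; set O := integral_orthogonal_group R F.
have TO k : O (cmx (transvection X k)).
  exists (transvection X k) => //; split; first exact: transvection_unit.
  by move=> x; rewrite -[in RHS](transvection_isometry k X3 XF) quadform_mul.
pose coset k : set 'M[C]_n := [set cmx (transvection X k) *m h | h in H].
move=> fin.
have [i [j [ij ijE]]] : exists i j : nat, i != j /\ coset i = coset j.
  apply: contrapT => noij; apply: infinite_nat.
  have -> : [set: nat] = (fun i : nat => coset i) @^-1`
       [set [set g *m h | h in H] | g in O].
    apply/seteqP; split=> // k _; exists (cmx (transvection X k)) => //.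
  apply: finite_preimage fin => i j _ _ E; apply/eqP; apply: contraPT E => ij E.
  by apply: noij; exists i, j.
pose k : int := j%:Z - i%:Z.
have k_neq0 : k != 0 by rewrite subr_eq0 eqz_nat eq_sym.
have Hk : H (cmx (transvection X k)).
  have : coset j (cmx (transvection X j)).
    by exists 1%:M; [exact: generated1 | rewrite mulmx1].
  rewrite -ijE => -[h Hh E].
  suff -> : cmx (transvection X k) = h by [].
  have -> : h = cmx (transvection X (- i%:Z)) *m cmx (transvection X j).
    by rewrite -E mulmxA -map_mxM transvectionD // addNr transvection0 map_mx1 mul1mx.
  by rewrite -map_mxM transvectionD // addrC.
have [g [_ g_side /map_int_mx_inj gE]] := generated_same_side Hk.
have side (m : nat) : same_side T l (ratmx (transvection X (m%:Z * k))).
  elim: m => [|m IHm]; first by rewrite mul0r transvection0 map_mx1; apply: same_side1.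
  rewrite intS mulrDl mul1r -transvectionD // map_mxM; apply: same_sideM => //.
  by rewrite gE.
pose q (w : 'cV[rat]_n) := 2 * k%:~R ^+ 2 * d%:~R ^+ 2 * (lv w * lv (N *m N *m w)).
have lT (m : nat) w : lv w * lv (ratmx (transvection X (m%:Z * k)) *m w) =
    lv w ^+ 2 + m%:R * (2 * k%:~R * (lv w * lv (ratmx X *m w))) + m%:R ^+ 2 * q w.
  rewrite ratmx_transvection !mulmxDl mul1mx -!scalemxAl !mulmxDr -!scalemxAr.
  have -> : l *m (ratmx X *m ratmx X *m w) = d%:~R ^+ 2 *: (l *m (N *m N *m w)).
    by rewrite XE -!scalemxAl -!scalemxAr -!scalemxAl -!scalemxAr scalerA.
  rewrite /q; move: (l *m w) (l *m (ratmx X *m w)) (l *m (N *m N *m w)) => u v z.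
  by rewrite !mxE !intrM /=; ring.
have c_gt0 : 0 < 2 * k%:~R ^+ 2 * d%:~R ^+ 2 :> rat.
  by apply: mulr_gt0; [apply: mulr_gt0 => // | ]; rewrite exprn_even_gt0 //= intr_eq0.
have q1 : 0 < - q w1 by rewrite oppr_gt0 pmulr_rlt0.
have q2 : 0 < q w2 by rewrite pmulr_rgt0.
have [M1 HM1] := quadratic_eventually_gt0
  (- (2 * k%:~R * (lv w1 * lv (ratmx X *m w1)))) (- lv w1 ^+ 2) q1.
have [M2 HM2] := quadratic_eventually_gt0
  (2 * k%:~R * (lv w2 * lv (ratmx X *m w2))) (lv w2 ^+ 2) q2.
have := (side (maxn M1 M2)).2 w1 w2 Tw1 Tw2.
have := HM1 _ (leq_maxl M1 M2); have := HM2 _ (leq_maxr M1 M2).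
rewrite -lT !mulrN -!opprD oppr_gt0 -lT => p2 p1.
by rewrite pmulr_lgt0 // ltNge ltW.
Qed.

End Criterion.

(** * From the criterion to thinness *)

Lemma int_isometry_unitmx n (F : 'M[rat]_n) (g : 'M[int]_n) : F \in unitmx ->
  (ratmx g)^T *m F *m ratmx g = F -> g \in unitmx.
Proof.
rewrite !unitmxE unitfE => Fu /(congr1 determinant).
rewrite !det_mulmx det_tr det_map_mx mulrAC -[RHS]mul1r => /(mulIf Fu).
rewrite -intrM => dg; have {}dg : \det g * \det g = 1 by apply: (@intr_inj rat).
by apply/unitrPr; exists (\det g).
Qed.

Lemma quadformZ n k (F : 'M[rat]_n) x : quadform (k *: F) x = k * quadform F x.
Proof. by rewrite /quadform -scalemxAr -scalemxAl mxE. Qed.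

Lemma integral_orthogonal_groupZ (R : realType) n k (F : 'M[rat]_n) : k != 0 ->
  integral_orthogonal_group R (k *: F) = integral_orthogonal_group R F.
Proof.
move=> k_neq0; rewrite /integral_orthogonal_group; congr image.
apply/seteqP; split=> g [gu gF]; split=> // x; last by rewrite !quadformZ gF.
by have := gF x; rewrite !quadformZ => /(mulfI k_neq0).
Qed.

Section ThinCriterion.
Variables (R : realType) (n : nat) (a b : seq rat) (p q : {poly int}).
Hypothesis ap : exponent_poly R a = map_poly intr p.
Hypothesis bq : exponent_poly R b = map_poly intr q.

Local Notation A := (companion n.+1 p).
Local Notation B := (companion n.+1 q).
Local Notation lv l w := ((l *m w) 0 0).

Variables (F : 'M[rat]_n.+1) (T : 'cV[rat]_n.+1 -> Prop) (l : 'rV[rat]_n.+1).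
Hypothesis (Fsym : F^T = F) (Fu : F \in unitmx) (Fsgn : has_signature F n 1).
Hypothesis AF : (ratmx A)^T *m F *m ratmx A = F.
Hypothesis BF : (ratmx B)^T *m F *m ratmx B = F.
Hypothesis AB : ratmx A != ratmx B.
Hypothesis l_neq0 : forall w, T w -> lv l w != 0.
Hypothesis (A_side : same_side T l (ratmx A)) (B_side : same_side T l (ratmx B)).
Variables (N : 'M[rat]_n.+1) (w1 w2 : 'cV[rat]_n.+1).
Hypothesis NF : N^T *m F = - (F *m N).
Hypothesis N3 : N *m N *m N = 0.
Hypothesis (Tw1 : T w1) (Tw2 : T w2).
Hypothesis w1_lt0 : lv l w1 * lv l (N *m N *m w1) < 0.
Hypothesis w2_gt0 : 0 < lv l w2 * lv l (N *m N *m w2).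

Lemma hypergeometric_groupE : hypergeometric_group R n.+1 a b =
  generated [set map_mx intr A; map_mx intr B].
Proof. by rewrite /hypergeometric_group ap bq !map_companion. Qed.

(** A second preserved form is proportional to [F], and proportional forms have
    the same integral isometries. *)
Lemma thin_half_space : thin (hypergeometric_group R n.+1 a b).
Proof.
have Au := int_isometry_unitmx Fu AF; have Bu := int_isometry_unitmx Fu BF.
split=> [|F' [F'sym F'u _ HF']].
  exists F; split=> //; first by left.
  rewrite hypergeometric_groupE => h.
  move=> /(generated_int_ind Au Bu (P := fun g => (ratmx g)^T *m F *m ratmx g = F)).
  case=> //.
  - by rewrite map_mx1 trmx1 mul1mx mulmx1.
  - move=> g g' gF g'F; rewrite map_mxM trmx_mul !mulmxA -[_ *m _ *m F]mulmxA.
    by rewrite -[_ *m _ *m ratmx g]mulmxA gF.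
  - move=> g gu gF; have gru := map_int_unitmx rat gu.
    rewrite -invmx_map_int // -[in LHS]gF !mulmxA trmx_inv.
    by rewrite mulVmx ?unitmx_tr // mul1mx mulmxK.
  move=> g [gu gF ->]; exists g => //; split=> // x.
  by rewrite -[in RHS]gF quadform_mul.
have F'_isometry g : hypergeometric_group R n.+1 a b (map_mx intr g) ->
    (ratmx g)^T *m F' *m ratmx g = F'.
  move=> /HF'[g' [_ g'F'] /map_int_mx_inj gg'].
  by apply: isometry_of_quadform => // x; rewrite -gg' g'F'.
have AH : hypergeometric_group R n.+1 a b (map_mx intr A).
  by rewrite hypergeometric_groupE; apply: generated_in; left.
have BH : hypergeometric_group R n.+1 a b (map_mx intr B).
  by rewrite hypergeometric_groupE; apply: generated_in; right.
have [|G|k k_neq0 ->] := @invariant_form_unique _ n (map_poly intr p) (map_poly intr q) F F'.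
- by rewrite !map_companion.
- by rewrite !map_companion => -[->|->]; split=> //; apply: F'_isometry.
rewrite integral_orthogonal_groupZ // hypergeometric_groupE.
exact: (infinite_index_half_space l_neq0 Au Bu A_side B_side NF N3 Tw1 Tw2
  w1_lt0 w2_gt0).
Qed.

End ThinCriterion.

(** * Eichler transvections *)

Section Eichler.
Variables (n : nat) (F : 'M[rat]_n) (e u : 'cV[rat]_n).
Hypothesis Fsym : F^T = F.
Hypothesis ee : e^T *m F *m e = 0.
Hypothesis eu : e^T *m F *m u = 0.

(** The infinitesimal generator of the Eichler transvections along the isotropic
    vector [e] in the direction of [u]. *)
Definition eichler : 'M[rat]_n := e *m (u^T *m F) - u *m (e^T *m F).

Lemma eichler_skew : eichler^T *m F = - (F *m eichler).
Proof.
rewrite /eichler linearB /= !trmx_mul !trmxK Fsym mulmxBl mulmxBr !mulmxA.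
by rewrite opprB.
Qed.

(** Three of the four products contain [f(e, e)] or [f(e, u)]. *)
Lemma eichler_sq : eichler *m eichler = - (quadform F u *: (e *m (e^T *m F))).
Proof.
have ue : u^T *m F *m e = 0.
  by have := congr1 trmx eu; rewrite !trmx_mul trmxK Fsym trmx0 mulmxA.
rewrite /eichler mulmxBl !mulmxBr.
have -> : e *m (u^T *m F) *m (e *m (u^T *m F)) = e *m (u^T *m F *m e) *m (u^T *m F).
  by rewrite !mulmxA.
have -> : e *m (u^T *m F) *m (u *m (e^T *m F)) = e *m (u^T *m F *m u) *m (e^T *m F).
  by rewrite !mulmxA.
have -> : u *m (e^T *m F) *m (e *m (u^T *m F)) = u *m (e^T *m F *m e) *m (u^T *m F).
  by rewrite !mulmxA.
have -> : u *m (e^T *m F) *m (u *m (e^T *m F)) = u *m (e^T *m F *m u) *m (e^T *m F).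
  by rewrite !mulmxA.
rewrite ee eu ue !mulmx0 !mul0mx subr0 sub0r subr0; congr (- _).
by rewrite [u^T *m F *m u]mx11_scalar mul_mx_scalar -scalemxAl.
Qed.

Lemma eichler_cube : eichler *m eichler *m eichler = 0.
Proof.
rewrite eichler_sq mulNmx -scalemxAl /eichler mulmxBr.
have -> : e *m (e^T *m F) *m (e *m (u^T *m F)) = e *m (e^T *m F *m e) *m (u^T *m F).
  by rewrite !mulmxA.
have -> : e *m (e^T *m F) *m (u *m (e^T *m F)) = e *m (e^T *m F *m u) *m (e^T *m F).
  by rewrite !mulmxA.
by rewrite ee eu !mulmx0 !mul0mx subr0 scaler0 oppr0.
Qed.

Lemma eichler_sq_mul (l : 'rV[rat]_n) (w : 'cV[rat]_n) : (l *m (eichler *m eichler *m w)) 0 0 =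
  - (quadform F u * ((l *m e) 0 0 * (e^T *m F *m w) 0 0)).
Proof.
rewrite eichler_sq mulNmx mulmxN -scalemxAl -scalemxAr.
have -> : l *m (e *m (e^T *m F) *m w) = l *m e *m (e^T *m F *m w) by rewrite !mulmxA.
rewrite [l *m e]mx11_scalar mul_scalar_mx.
by rewrite !(mxE, mulr1n).
Qed.

End Eichler.

Lemma signature_unitmx n (F : 'M[rat]_n.+1) : has_signature F n 1 -> F \in unitmx.
Proof.
move=> [S [d [Su E cp cn]]].
have d_neq0 i : d 0 i != 0.
  apply/eqP => di0.
  have : (#|([set i | (0 < d 0 i)%R] :|: [set i | (d 0 i < 0)%R])%SET| <= n)%N.
    have cC : #|[set~ i]%SET| = n by rewrite cardsC1 card_ord.
    rewrite -[leqRHS]cC; apply: subset_leq_card.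
    apply/fintype.subsetP => j; rewrite !inE; case: eqP => // ->.
    by rewrite di0 ltxx.
  rewrite cardsU cp cn.
  rewrite (_ : (_ :&: _)%SET = finset.set0) ?cards0 ?subn0 ?addn1 ?ltnn //.
  by apply/setP => j; rewrite !inE; case: ltgtP.
have := congr1 determinant E; rewrite !det_mulmx det_tr det_diag => detE.
rewrite unitmxE unitfE; apply/eqP => F0; move: detE; rewrite F0 mulr0 mul0r.
by move/esym/eqP/prodf_eq0 => [i _]; rewrite (negPf (d_neq0 i)).
Qed.

(** The quantities in the last two hypotheses are, up to the positive factor
    [f(u, u)], the opposites of [l(w) l(N^2 w)] for the generator [N] of the
    transvections. *)
Lemma thin_eichler (R : realType) n (a b : seq rat) (p q : {poly int})
    (F : 'M[rat]_n.+1) (T : 'cV[rat]_n.+1 -> Prop) (l : 'rV[rat]_n.+1)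
    (e u w1 w2 : 'cV[rat]_n.+1) :
    exponent_poly R a = map_poly intr p -> exponent_poly R b = map_poly intr q ->
    F^T = F -> has_signature F n 1 ->
    (ratmx (companion n.+1 p))^T *m F *m ratmx (companion n.+1 p) = F ->
    (ratmx (companion n.+1 q))^T *m F *m ratmx (companion n.+1 q) = F ->
    ratmx (companion n.+1 p) != ratmx (companion n.+1 q) ->
    (forall w, T w -> (l *m w) 0 0 != 0) ->
    same_side T l (ratmx (companion n.+1 p)) ->
    same_side T l (ratmx (companion n.+1 q)) ->
    e^T *m F *m e = 0 -> e^T *m F *m u = 0 -> 0 < quadform F u ->
    T w1 -> T w2 ->
    0 < (l *m w1) 0 0 * ((l *m e) 0 0 * (e^T *m F *m w1) 0 0) ->
    (l *m w2) 0 0 * ((l *m e) 0 0 * (e^T *m F *m w2) 0 0) < 0 ->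
  thin (hypergeometric_group R n.+1 a b).
Proof.
move=> ap bq Fsym Fsgn AF BF AB l0 As Bs ee eu uu Tw1 Tw2 h1 h2.
have Fu := signature_unitmx Fsgn.
apply: (thin_half_space ap bq Fsym Fu Fsgn AF BF AB l0 As Bs
  (eichler_skew e u Fsym) (eichler_cube Fsym ee eu) Tw1 Tw2).
  by rewrite eichler_sq_mul // mulrN oppr_lt0 mulrCA pmulr_rgt0.
by rewrite eichler_sq_mul // mulrN oppr_gt0 mulrCA pmulr_rlt0.
Qed.

(** * First family: the polynomials *)

Section PolyI.
Variables (k : nat).
Hypothesis (k_even : ~~ odd k) (k_gt0 : (0 < k)%N).

Definition poly_a1 : {poly int} := \poly_(i < k.+2) (-1) ^+ i.+1.
Definition poly_b1 : {poly int} :=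
  \poly_(i < k.+2) (if (i == 0)%N || (i == k.+1) then 1 else 2).

Lemma poly_a1_mul : poly_a1 * ('X + 1) = 'X^(k.+2) - 1.
Proof.
apply/polyP => i; rewrite mulrDr mulr1 coefD coefMX coefB coefXn coef1 !coef_poly.
case: i => [|i] /=; first by rewrite add0r expr1.
rewrite !eqSS subr0 !ltnS; case: (ltngtP i k.+1) => ik.
- have -> : (i <= k)%N by lia.
  by rewrite [(-1) ^+ i.+2]exprS mulN1r subrr.
- by have -> : (i <= k)%N = false by lia.
- have -> : (i <= k)%N = false by lia.
  by rewrite ik addr0 -signr_odd /= negbK (negPf k_even).
Qed.

Lemma poly_b1_mul : poly_b1 * ('X - 1) = ('X + 1) * ('X^(k.+1) - 1).
Proof.
apply/polyP => i.
rewrite [RHS](_ : _ = ('X^(k.+2) + 'X^(k.+1) - 'X - 1)`_i); last first.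
  by congr (nth 0 (polyseq _) i); rewrite ['X^(k.+2)]exprS; ring.
rewrite mulrBr mulr1 !coefB coefMX coefD !coefXn coefX coef1 !coef_poly.
case: i => [|[|i]] //=; rewrite ?eqSS ?ltnS.
- by have -> : (0 == k)%N = false by lia.
case: (ltngtP i.+1 k) => ik.
- have -> : (i == k) = false by lia.
  have -> : (i <= k)%N by lia.
  by rewrite subrr.
- have -> : (i <= k)%N = (i == k) by lia.
  by case: eqP.
- have -> : (i == k) = false by lia.
  by have -> : (i <= k)%N by lia.
Qed.

End PolyI.

Lemma exponent_poly_alpha1_int (R : realType) k : ~~ odd k -> (0 < k)%N ->
  exponent_poly R (alpha1 k.+1) = map_poly intr (poly_a1 k).
Proof.
move=> k_even k_gt0; have Xp1_neq0 : 'X + 1 != 0 :> {poly R[i]} by rewrite -size_poly_eq0 size_XaddC.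
apply: (mulIf Xp1_neq0); rewrite exponent_poly_alpha1 //.
have -> : 'X + 1 = map_poly intr ('X + 1) :> {poly R[i]} by rewrite rmorphD rmorph1 /= map_polyX.
by rewrite -rmorphM /= poly_a1_mul // rmorphB rmorph1 /= map_polyXn.
Qed.

Lemma exponent_poly_beta1_int (R : realType) k : ~~ odd k -> (0 < k)%N ->
  exponent_poly R (beta1 k.+1) = map_poly intr (poly_b1 k).
Proof.
move=> k_even k_gt0; have Xm1_neq0 : 'X - 1 != 0 :> {poly R[i]} by rewrite polyXsubC_eq0.
apply: (mulIf Xm1_neq0); rewrite exponent_poly_beta1 //.
have -> : 'X - 1 = map_poly intr ('X - 1) :> {poly R[i]} by rewrite rmorphB rmorph1 /= map_polyX.
by rewrite -rmorphM /= poly_b1_mul // rmorphM rmorphB rmorphD rmorph1 /= map_polyXn map_polyX.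
Qed.

(** * First family: the invariant form *)

Lemma companion_mul0 (K : comNzRingType) n (p : {poly K}) (x : 'cV[K]_n.+1) :
  (companion n.+1 p *m x) 0 0 = - (p`_0 * x ord_max 0).
Proof.
rewrite mxE big_ord_recr /= big1 => [|j _]; rewrite !mxE /= ?eqxx ?mulNr ?add0r //.
by rewrite ltn_eqF ?ltn_ord // mul0r.
Qed.

Lemma companion_mulS (K : comNzRingType) n (p : {poly K}) (x : 'cV[K]_n.+1) (i : 'I_n) :
  (companion n.+1 p *m x) (lift ord0 i) 0 =
    x (widen_ord (leqnSn n) i) 0 - p`_i.+1 * x ord_max 0.
Proof.
rewrite mxE big_ord_recr /= !mxE /= eqxx mulNr; congr (_ - _).
rewrite (bigD1 i) //= big1 ?addr0 => [|j ji]; rewrite !mxE /= ltn_eqF ?ltn_ord //.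
  by rewrite eqxx mul1r.
rewrite (_ : _ == _ = false) ?mul0r //; apply: contraNF ji.
by move/eqP => [] /val_inj ->.
Qed.

Definition int_col n (w : 'cV[rat]_n) : Prop := exists z : 'cV[int]_n, w = ratmx z.

Lemma int_col_mul n (g : 'M[int]_n) w : g \in unitmx ->
  int_col (ratmx g *m w) <-> int_col w.
Proof.
move=> gu; split=> [[z zE]|[z ->]]; last by exists (g *m z); rewrite map_mxM.
exists (invmx g *m z); rewrite map_mxM -zE mulmxA -map_mxM mulVmx //.
by rewrite map_mx1 mul1mx.
Qed.

Section FamilyI.
Variable (k : nat).
Hypotheses (k_even : ~~ odd k) (k_ge4 : (4 <= k)%N).

Local Notation vec := ('cV[rat]_k.+1).
Local Notation K := (k%:R : rat).
Implicit Types x w : vec.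

Let A := ratmx (companion k.+1 (poly_a1 k)).
Let B := ratmx (companion k.+1 (poly_b1 k)).

Definition sgn_col : vec := \col_i (-1) ^+ i.
Definition one_col : vec := const_mx 1.
Definition csum x : rat := \sum_i x i 0.
Definition alt x : rat := \sum_(i < k.+1) (-1) ^+ i * x i 0.
Definition sqn x : rat := \sum_i x i 0 ^+ 2.

(** [A] preserves both the sum of the coordinates and
    [|x|^2 - alt(x)^2 / (k + 2)]; invariance under [B] then fixes the multiple of
    [csum(x)^2] to be subtracted. *)
Definition form1 : 'M[rat]_k.+1 :=
  1%:M - (K + 2)^-1 *: (sgn_col *m sgn_col^T) - (K + 1)^-1 *: (one_col *m one_col^T).

Lemma form1_sym : form1^T = form1.
Proof. by rewrite /form1 !linearB /= !linearZ /= !trmx_mul !trmxK trmx1. Qed.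

Lemma tr_one_mul x : one_col^T *m x = (csum x)%:M.
Proof.
rewrite [LHS]mx11_scalar; congr _%:M; rewrite mxE.
by apply: eq_bigr => i _; rewrite !mxE mul1r.
Qed.

Lemma tr_sgn_mul x : sgn_col^T *m x = (alt x)%:M.
Proof.
rewrite [LHS]mx11_scalar; congr _%:M; rewrite mxE.
by apply: eq_bigr => i _; rewrite !mxE.
Qed.

Lemma form1_mul x : form1 *m x =
  x - (alt x / (K + 2)) *: sgn_col - (csum x / (K + 1)) *: one_col.
Proof.
rewrite /form1 !mulmxBl mul1mx -!scalemxAl -!mulmxA tr_one_mul tr_sgn_mul.
by rewrite !mul_mx_scalar !scalerA ![_^-1 * _]mulrC.
Qed.

Lemma quadform1 x :
  quadform form1 x = sqn x - alt x ^+ 2 / (K + 2) - csum x ^+ 2 / (K + 1).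
Proof.
rewrite /quadform -mulmxA form1_mul !mulmxBr -!scalemxAr.
have -> : x^T *m sgn_col = (alt x)%:M by rewrite -[LHS]trmxK trmx_mul trmxK tr_sgn_mul tr_scalar_mx.
have -> : x^T *m one_col = (csum x)%:M by rewrite -[LHS]trmxK trmx_mul trmxK tr_one_mul tr_scalar_mx.
have -> : x^T *m x = (sqn x)%:M.
  rewrite [LHS]mx11_scalar; congr _%:M; rewrite mxE.
  by apply: eq_bigr => i _; rewrite !mxE expr2.
by rewrite !mxE /=; ring.
Qed.

Lemma coef_a1 i : (i <= k.+1)%N -> (poly_a1 k)`_i = (-1) ^+ i.+1.
Proof. by move=> ik; rewrite coef_poly ltnS ik. Qed.

Lemma coef_b1S i : (i < k)%N -> (poly_b1 k)`_i.+1 = 2.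
Proof.
move=> ik; rewrite coef_poly /= eqSS.
have -> : (i.+1 < k.+2)%N by lia.
by have -> : (i == k) = false by lia.
Qed.

Local Notation wid := (widen_ord (leqnSn k)).

Lemma A_mul0 x : (A *m x) 0 0 = x ord_max 0.
Proof.
rewrite /A -map_companion companion_mul0 coef_map coef_a1 //=.
by rewrite expr1 rmorphN1 mulN1r opprK.
Qed.

Lemma A_mulS x (i : 'I_k) :
  (A *m x) (lift ord0 i) 0 = x (wid i) 0 - (-1) ^+ i * x ord_max 0.
Proof.
rewrite /A -map_companion companion_mulS coef_map coef_a1; last first.
  by have := ltn_ord i; lia.
by rewrite /= !exprS !mulN1r opprK rmorphXn /= rmorphN1.
Qed.

Lemma B_mul0 x : (B *m x) 0 0 = - x ord_max 0.
Proof.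
by rewrite /B -map_companion companion_mul0 coef_map coef_poly /= mul1r.
Qed.

Lemma B_mulS x (i : 'I_k) : (B *m x) (lift ord0 i) 0 = x (wid i) 0 - 2 * x ord_max 0.
Proof. by rewrite /B -map_companion companion_mulS coef_map coef_b1S ?ltn_ord. Qed.

Lemma sum_sgn : \sum_(i < k) (-1) ^+ i = 0 :> rat.
Proof.
have -> : k = (k./2).*2 by rewrite -[LHS]odd_double_half (negPf k_even).
elim: (k./2) => [|m IHm]; first by rewrite big_ord0.
by rewrite doubleS !big_ord_recr /= IHm add0r exprS mulN1r subrr.
Qed.

Lemma sgn_max : (-1) ^+ k = 1 :> rat.
Proof. by rewrite -signr_odd (negPf k_even). Qed.

Section Init.
Variable x : vec.
Let L := x ord_max 0.
Let s := \sum_(i < k) x (wid i) 0.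
Let d := \sum_(i < k) (-1) ^+ i * x (wid i) 0.
Let r := \sum_(i < k) x (wid i) 0 ^+ 2.

Lemma csumE : csum x = s + L. Proof. by rewrite /csum big_ord_recr. Qed.
Lemma altE : alt x = d + L.
Proof. by rewrite /alt big_ord_recr /= sgn_max mul1r. Qed.
Lemma sqnE : sqn x = r + L ^+ 2. Proof. by rewrite /sqn big_ord_recr. Qed.

Lemma csum_A : csum (A *m x) = csum x.
Proof.
rewrite csumE /csum big_ord_recl A_mul0 (eq_bigr _ (fun i _ => A_mulS x i)).
by rewrite sumrB -mulr_suml sum_sgn mul0r subr0 addrC.
Qed.

Lemma alt_A : alt (A *m x) = (K + 1) * L - d.
Proof.
rewrite /alt big_ord_recl A_mul0 /= mul1r.
rewrite (eq_bigr (fun i : 'I_k => L - (-1) ^+ i * x (wid i) 0)) => [|i _].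
  by rewrite sumrB sumr_const card_ord -/L -/d -mulr_natl; ring.
rewrite A_mulS exprS -/L mulrBr mulrA -!mulrA; have := sqrr_sign rat i.
by rewrite expr2 => E; rewrite !mulN1r [_ * (_ * L)]mulrA E; ring.
Qed.

Lemma sqn_A : sqn (A *m x) = r - 2 * d * L + (K + 1) * L ^+ 2.
Proof.
rewrite /sqn big_ord_recl A_mul0.
rewrite (eq_bigr (fun i : 'I_k => x (wid i) 0 ^+ 2 -
   2 * ((-1) ^+ i * x (wid i) 0) * L + L ^+ 2)) => [|i _].
  rewrite big_split /= sumrB sumr_const card_ord -/L -mulr_suml -mulr_sumr.
  by rewrite -/r -/d -mulr_natl; ring.
have := sqrr_sign rat i; rewrite A_mulS -/L; set u := (-1) ^+ i => E.
by rewrite sqrrB exprMn E mul1r; ring.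
Qed.

Lemma csum_B : csum (B *m x) = s - (2 * K + 1) * L.
Proof.
rewrite /csum big_ord_recl B_mul0 (eq_bigr _ (fun i _ => B_mulS x i)).
by rewrite sumrB sumr_const card_ord -/L -/s -mulr_natl; ring.
Qed.

Lemma alt_B : alt (B *m x) = - (d + L).
Proof.
rewrite /alt big_ord_recl B_mul0 /= mul1r.
rewrite (eq_bigr (fun i : 'I_k => (-1) ^+ i * (2 * L) - (-1) ^+ i * x (wid i) 0)) => [|i _].
  by rewrite sumrB -mulr_suml sum_sgn -/L -/d; ring.
by rewrite B_mulS exprS -/L; ring.
Qed.

Lemma sqn_B : sqn (B *m x) = r - 4 * s * L + (4 * K + 1) * L ^+ 2.
Proof.
rewrite /sqn big_ord_recl B_mul0.
rewrite (eq_bigr (fun i : 'I_k => x (wid i) 0 ^+ 2 -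
   4 * x (wid i) 0 * L + 4 * L ^+ 2)) => [|i _].
  rewrite big_split /= sumrB sumr_const card_ord -/L -mulr_suml -mulr_sumr.
  by rewrite -/r -/s -mulr_natl; ring.
by rewrite B_mulS -/L; ring.
Qed.

(** Bessel's inequality for the constant and the alternating vector, which are
    orthogonal in even dimension [k]. *)
Lemma bessel : (s ^+ 2 + d ^+ 2) / K <= r.
Proof.
have K_gt0 : 0 < K by rewrite ltr0n; lia.
rewrite -subr_ge0.
suff -> : r - (s ^+ 2 + d ^+ 2) / K =
    \sum_(i < k) (x (wid i) 0 - (s + (-1) ^+ i * d) / K) ^+ 2.
  by apply: sumr_ge0 => i _; apply: sqr_ge0.
rewrite (eq_bigr (fun i : 'I_k => x (wid i) 0 ^+ 2 - (2 * s / K) * x (wid i) 0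
  - (2 * d / K) * ((-1) ^+ i * x (wid i) 0) + (2 * s * d / K ^+ 2) * (-1) ^+ i
  + (s ^+ 2 + d ^+ 2) / K ^+ 2)) => [|i _].
  rewrite !big_split /= !sumrN -!mulr_sumr sum_sgn sumr_const card_ord -/r -/s -/d.
  by rewrite -mulr_natl; field; rewrite lt0r_neq0.
have := sqrr_sign rat i; set u := (-1) ^+ i => E.
have -> : (s ^+ 2 + d ^+ 2) / K ^+ 2 = (s ^+ 2 + u ^+ 2 * d ^+ 2) / K ^+ 2.
  by rewrite E mul1r.
by field; rewrite lt0r_neq0.
Qed.

End Init.

Lemma K_gt0 : 0 < K. Proof. by rewrite ltr0n; lia. Qed.

Lemma form1_A : A^T *m form1 *m A = form1.
Proof.
apply: isometry_of_quadform => [|x]; first exact: form1_sym.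
have := K_gt0 => K_gt0.
rewrite !quadform1 csum_A alt_A sqn_A csumE altE sqnE.
by field; apply/andP; split; apply: lt0r_neq0; lra.
Qed.

Lemma form1_B : B^T *m form1 *m B = form1.
Proof.
apply: isometry_of_quadform => [|x]; first exact: form1_sym.
have := K_gt0 => K_gt0.
rewrite !quadform1 csum_B alt_B sqn_B csumE altE sqnE.
by field; apply/andP; split; apply: lt0r_neq0; lra.
Qed.

(** The constant vector is timelike.  On its orthogonal complement the
    alternating sum vanishes, and what is left is the squared distance to the
    line of constant vectors. *)
Lemma form1_signature : has_signature form1 k 1.
Proof.
pose S : 'M[rat]_(1 + k) := block_mx 1%:M 0 (const_mx 1) 1%:M.
have Su : S \in unitmx by rewrite unitmxE det_lblock !det1 mulr1 unitr1.
have SE : S *m delta_mx 0 0 = one_col.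
  rewrite -colE; apply/matrixP => i j; rewrite (ord1 j) !mxE.
  by case: splitP => i' _; rewrite !mxE; case: splitP => // j' j'0;
    rewrite !mxE ?(ord1 i') ?(ord1 j').
have csum1 : csum one_col = K + 1.
  rewrite /csum (eq_bigr (fun=> 1)) => [|i _]; last by rewrite mxE.
  by rewrite sumr_const card_ord -natr1.
have alt1 : alt one_col = 1.
  rewrite /alt big_ord_recr /= mxE mulr1 sgn_max (eq_bigr (fun i : 'I_k => (-1) ^+ i)).
    by rewrite sum_sgn add0r.
  by move=> i _; rewrite mxE mulr1.
have sqn1 : sqn one_col = K + 1.
  rewrite /sqn (eq_bigr (fun=> 1)) => [|i _]; last by rewrite mxE expr1n.
  by rewrite sumr_const card_ord -natr1.
have K_gt0 := K_gt0.
apply: (@lorentz_signature k form1 S) => //; first exact: form1_sym.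
  rewrite SE quadform1 csum1 alt1 sqn1.
  have -> : K + 1 - 1 ^+ 2 / (K + 2) - (K + 1) ^+ 2 / (K + 1) = - (K + 2)^-1.
    by field; apply/andP; split; apply: lt0r_neq0; lra.
  by rewrite oppr_lt0 invr_gt0; lra.
move=> x x_neq0; rewrite SE -mulmxA form1_mul !mulmxBr -!scalemxAr.
rewrite !tr_one_mul => /matrixP/(_ 0 0).
have csum_sgn : csum sgn_col = 1.
  rewrite /csum big_ord_recr /= mxE sgn_max (eq_bigr (fun i : 'I_k => (-1) ^+ i)).
    by rewrite sum_sgn add0r.
  by move=> i _; rewrite mxE.
rewrite !mxE csum_sgn csum1 /= !mulr1n mulr1 => H.
have alt0 : alt x = 0.
  have : alt x = - (csum x - alt x / (K + 2) - csum x / (K + 1) * (K + 1)) * (K + 2).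
    by field; apply/andP; split; apply: lt0r_neq0; lra.
  by rewrite H oppr0 mul0r.
rewrite quadform1 alt0 expr0n /= mul0r subr0.
set c := csum x / (K + 1).
have -> : sqn x - csum x ^+ 2 / (K + 1) = \sum_i (x i 0 - c) ^+ 2.
  rewrite (eq_bigr (fun i => x i 0 ^+ 2 - (2 * c) * x i 0 + c ^+ 2)) => [|i _]; last by ring.
  rewrite big_split /= sumrB -mulr_sumr sumr_const card_ord -mulr_natl -natr1.
  by rewrite -/(sqn x) -/(csum x) /c; field; apply: lt0r_neq0; lra.
rewrite lt_def sumr_ge0 ?andbT => [|i _]; last exact: sqr_ge0.
apply: contraNneq x_neq0 => /eqP.
rewrite psumr_eq0 => [/allP xc|i _]; last exact: sqr_ge0.
have xE : x = c *: one_col.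
  apply/matrixP => i j; rewrite (ord1 j) !mxE mulr1; apply/eqP.
  by have := xc i (mem_index_enum i); rewrite sqrf_eq0 subr_eq0.
have altZ : alt (c *: one_col) = c * alt one_col.
  by rewrite /alt mulr_sumr; apply: eq_bigr => i _; rewrite !mxE; ring.
by move: alt0; rewrite xE altZ alt1 mulr1 => ->; rewrite scale0r.
Qed.

Lemma form1_unit : form1 \in unitmx.
Proof. exact: signature_unitmx form1_signature. Qed.

(** The value of the form at [one_col - delta_i] for odd [i]. *)
Definition nu1 : rat := (K ^+ 2 - 2 * K - 4) / ((K + 1) * (K + 2)).

(** [B] changes the sum of the coordinates by multiples of [2 (k + 1)]; the
    congruence keeps that sum at least [k] in absolute value. *)
Definition walls1 (w : vec) : Prop :=
  [/\ int_col w, quadform form1 w = nu1 &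
      exists j : int, csum w = K + 2 * (K + 1) * j%:~R].

(** If the product of the last coordinate and the sum is not positive, Bessel's
    inequality for the other coordinates gives norm at least [k / (k + 1)], which
    exceeds [nu1]. *)
Lemma walls1_sign w : walls1 w -> 0 < w ord_max 0 * csum w.
Proof.
move=> [_ Qw [j Sj]]; have K_gt0 := K_gt0.
have S_ge : K ^+ 2 <= csum w ^+ 2.
  rewrite -subr_ge0 Sj.
  have -> : (K + 2 * (K + 1) * j%:~R) ^+ 2 - K ^+ 2 =
     4 * (K + 1) * (j%:~R * (K + (K + 1) * j%:~R)) by ring.
  apply: mulr_ge0; first by lra.
  have [j_ge0|j_lt0] := leP 0 j.
    have jq : 0 <= j%:~R :> rat by rewrite ler0z.
    by rewrite mulr_ge0 // addr_ge0 ?mulr_ge0 //; lra.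
  have jq : j%:~R <= -1 :> rat by rewrite -[-1]/((-1)%:~R) ler_int; lia.
  by rewrite mulr_le0 //; [lra | nra].
rewrite ltNge; apply/negP => LS.
have := bessel w; move: Qw S_ge LS; rewrite quadform1 csumE altE sqnE.
set L := w ord_max 0; set s := \sum_(i < k) w _ 0.
set d := \sum_(i < k) _ * _; set r := \sum_(i < k) _ ^+ 2 => Qw S_ge LS r_ge.
have : K / (K + 1) <= nu1.
  rewrite -Qw -subr_ge0.
  have -> : r + L ^+ 2 - (d + L) ^+ 2 / (K + 2) - (s + L) ^+ 2 / (K + 1) - K / (K + 1) =
    (r - (s ^+ 2 + d ^+ 2) / K) + ((s + L) ^+ 2 - K ^+ 2) / (K * (K + 1))
    + 2 * (- (L * (s + L))) / K + (K^-1 + 2^-1) * L ^+ 2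
    + 2 * (d - K * L / 2) ^+ 2 / (K * (K + 2)).
    by field; apply/and3P; split; apply: lt0r_neq0; lra.
  have [K1 K2] : 0 < K + 1 /\ 0 < K + 2 by split; lra.
  have Ki : 0 <= K^-1 + 2^-1 by rewrite addr_ge0 // invr_ge0 ltW.
  have t1 : 0 <= r - (s ^+ 2 + d ^+ 2) / K by rewrite subr_ge0.
  have t2 : 0 <= ((s + L) ^+ 2 - K ^+ 2) / (K * (K + 1)).
    by rewrite divr_ge0 ?subr_ge0 // mulr_ge0 // ltW.
  have t3 : 0 <= 2 * (- (L * (s + L))) / K.
    by rewrite divr_ge0 ?(ltW K_gt0) // mulr_ge0 // oppr_ge0.
  have t4 : 0 <= (K^-1 + 2^-1) * L ^+ 2 by rewrite mulr_ge0 ?sqr_ge0.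
  have t5 : 0 <= 2 * (d - K * L / 2) ^+ 2 / (K * (K + 2)).
    apply: divr_ge0; first by apply: mulr_ge0 => //; apply: sqr_ge0.
    by apply: mulr_ge0; apply: ltW.
  lra.
apply/negP; rewrite -ltNge /nu1 -subr_gt0.
have -> : K / (K + 1) - (K ^+ 2 - 2 * K - 4) / ((K + 1) * (K + 2)) =
  4 / (K + 2).
  by field; apply/andP; split; apply: lt0r_neq0; lra.
by rewrite divr_gt0 //; lra.
Qed.

End FamilyI.

(** * First family: walls and thinness *)

Lemma delta_row_mul n (w : 'cV[rat]_n) i : ((delta_mx 0 i : 'rV_n) *m w) 0 0 = w i 0.
Proof. by rewrite -rowE mxE. Qed.

Lemma quadform_isometry n (F g : 'M[rat]_n) x : g^T *m F *m g = F ->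
  quadform F (g *m x) = quadform F x.
Proof. by move=> gF; rewrite -[in RHS]gF quadform_mul. Qed.

Lemma same_sign_mulr (s a b : rat) : 0 < a * s -> 0 < b * s -> 0 < a * b.
Proof.
move=> as_gt0 bs_gt0; have := mulr_gt0 as_gt0 bs_gt0.
have -> : a * s * (b * s) = a * b * s ^+ 2 by ring.
rewrite pmulr_lgt0 // exprn_even_gt0 //=.
by apply: contraTneq as_gt0 => ->; rewrite mulr0 ltxx.
Qed.

Section FamilyI.
Variables (R : realType) (k : nat).
Hypotheses (k_even : ~~ odd k) (k_ge4 : (4 <= k)%N).

Local Notation vec := ('cV[rat]_k.+1).
Local Notation K := (k%:R : rat).
Implicit Types x w : vec.

Let A := ratmx (companion k.+1 (poly_a1 k)).
Let B := ratmx (companion k.+1 (poly_b1 k)).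
Let l : 'rV[rat]_k.+1 := delta_mx 0 ord_max.

Let AF : A^T *m form1 k *m A = form1 k := form1_A k_even k_ge4.
Let BF : B^T *m form1 k *m B = form1 k := form1_B k_even k_ge4.
Let Fu : form1 k \in unitmx := form1_unit k_even k_ge4.

Let Ai : companion k.+1 (poly_a1 k) \in unitmx := int_isometry_unitmx Fu AF.
Let Bi : companion k.+1 (poly_b1 k) \in unitmx := int_isometry_unitmx Fu BF.

Lemma walls1_A w : walls1 (A *m w) <-> walls1 w.
Proof.
have iA := int_col_mul w Ai; rewrite /walls1 (quadform_isometry _ AF) csum_A //.
by split=> -[/iA w_int Qw jw]; split.
Qed.

Lemma csum_B_last w : csum (B *m w) = csum w - 2 * (K + 1) * w ord_max 0.
Proof. by rewrite csum_B // csumE; ring. Qed.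

Lemma walls1_B w : walls1 (B *m w) <-> walls1 w.
Proof.
have iB := int_col_mul w Bi; rewrite /walls1 (quadform_isometry _ BF) csum_B_last.
have shift (m : int) c : (exists j : int, c - 2 * (K + 1) * m%:~R = K + 2 * (K + 1) * j%:~R)
    <-> exists j : int, c = K + 2 * (K + 1) * j%:~R.
  split=> -[j jE]; first by exists (j + m); rewrite intrD; lra.
  by exists (j - m); rewrite jE intrB; lra.
split=> [[/iB.1 w_int Qw jw]|[w_int Qw jw]]; split=> //; first 1 last.
- exact/iB.
- by have [z zE] := w_int; move: jw; rewrite zE !mxE; apply: (shift _ _).2.
- by have [z zE] := w_int; move: jw; rewrite zE !mxE; apply: (shift _ _).1.
Qed.

Lemma walls1_side_A : same_side (@walls1 k) l A.
Proof.
split=> [|w w' Tw Tw']; first exact: walls1_A.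
have pos v : walls1 v -> 0 < v ord_max 0 * (A *m v) ord_max 0.
  move=> Tv; apply: (@same_sign_mulr (csum v)); first exact: (walls1_sign k_even k_ge4 Tv).
  rewrite -(csum_A k_even) //; apply: (walls1_sign k_even k_ge4).
  exact: (walls1_A v).2.
by rewrite !delta_row_mul mulr_gt0 ?pos.
Qed.

(** The last coordinate changes sign under the reflection [A^-1 B], while the
    sum of the coordinates is preserved by [A]. *)
Lemma walls1_side_B : same_side (@walls1 k) l B.
Proof.
split=> [|w w' Tw Tw']; first exact: walls1_B.
have neg v : walls1 v -> v ord_max 0 * (B *m v) ord_max 0 < 0.
  move=> Tv; have TBv : walls1 (B *m v) by exact: (walls1_B v).2.
  pose v' := invmx A *m (B *m v).
  have Av' : A *m v' = B *m v by rewrite mulKVmx // map_int_unitmx.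
  have TAv' : walls1 (A *m v') := eq_ind_r (@walls1 k) TBv Av'.
  have Tv' : walls1 v' := (walls1_A v').1 TAv'.
  have v'E : v' ord_max 0 = - v ord_max 0.
    by rewrite -(B_mul0 v) -(A_mul0 v') -/A -/B Av'.
  have cv' : csum v' = csum (B *m v) by rewrite -Av' csum_A.
  have := walls1_sign k_even k_ge4 Tv'; rewrite cv' v'E.
  move=> /same_sign_mulr/(_ (walls1_sign k_even k_ge4 TBv)).
  by rewrite mulNr oppr_gt0.
by rewrite !delta_row_mul nmulr_rgt0 ?neg.
Qed.

Lemma csumD x y : csum (x + y) = csum x + csum y.
Proof. by rewrite /csum -big_split; apply: eq_bigr => i _; rewrite mxE. Qed.
Lemma csumZ c x : csum (c *: x) = c * csum x.
Proof. by rewrite /csum mulr_sumr; apply: eq_bigr => i _; rewrite mxE. Qed.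
Lemma altD x y : alt (x + y) = alt x + alt y.
Proof. by rewrite /alt -big_split; apply: eq_bigr => i _; rewrite mxE mulrDr. Qed.
Lemma altZ c x : alt (c *: x) = c * alt x.
Proof. by rewrite /alt mulr_sumr; apply: eq_bigr => i _; rewrite mxE mulrCA. Qed.

Definition unitv i : vec := delta_mx (inord i) 0.

Lemma unitvE i j : (i <= k)%N -> (j <= k)%N -> unitv i (inord j) 0 = (j == i)%:R.
Proof.
move=> ik jk; rewrite mxE eqxx andbT; congr (_%:R).
by rewrite -(inj_eq val_inj) /= !inordK ?ltnS.
Qed.

Lemma csum_unitv i : csum (unitv i) = 1.
Proof.
rewrite /csum (bigD1 (inord i)) //= big1 ?addr0 => [|j ji]; rewrite !mxE ?eqxx //.
by rewrite (negPf ji).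
Qed.

Lemma alt_unitv i : (i <= k)%N -> alt (unitv i) = (-1) ^+ i.
Proof.
move=> ik; rewrite /alt (bigD1 (inord i)) //= big1 ?addr0 => [|j ji]; rewrite !mxE.
  by rewrite !eqxx mulr1 inordK.
by rewrite (negPf ji) mulr0.
Qed.

Lemma tr_unitv_mul i x : (unitv i)^T *m x = (x (inord i) 0)%:M.
Proof. by rewrite trmx_delta -rowE [LHS]mx11_scalar mxE. Qed.

Lemma csum_one : csum (one_col k) = K + 1.
Proof.
rewrite /csum (eq_bigr (fun=> 1)) => [|i _]; last by rewrite mxE.
by rewrite sumr_const card_ord -natr1.
Qed.

Lemma csum_sgn : csum (sgn_col k) = 1.
Proof.
rewrite /csum big_ord_recr /= mxE (sgn_max k_even) // (eq_bigr (fun i : 'I_k => (-1) ^+ i)).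
  by rewrite sum_sgn // add0r.
by move=> i _; rewrite mxE.
Qed.

Lemma alt_one : alt (one_col k) = 1.
Proof. by rewrite -csum_sgn; apply: eq_bigr => i _; rewrite !mxE mulr1. Qed.

Lemma alt_sgn : alt (sgn_col k) = K + 1.
Proof.
rewrite -csum_one; apply: eq_bigr => i _; rewrite !mxE -expr2 sqrr_sign //.
Qed.

Lemma walls1_mem i : (i <= k)%N -> odd i -> walls1 (one_col k - unitv i).
Proof.
move=> ik i_odd; have K_gt0 := K_gt0 k_even k_ge4.
have cs : csum (one_col k - unitv i) = K.
  by rewrite -scaleN1r csumD csumZ csum_one csum_unitv; ring.
split; first by exists (const_mx 1 - delta_mx (inord i) 0); rewrite map_mxB map_delta_mx map_const_mx.
  have -> : quadform (form1 k) (one_col k - unitv i) =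
     csum (one_col k - unitv i) - 4 / (K + 2) - K ^+ 2 / (K + 1).
    rewrite quadform1 cs -scaleN1r altD altZ alt_one alt_unitv // -signr_odd i_odd.
    congr (_ - _ / _ - _).
    rewrite scaleN1r -cs; apply: eq_bigr => j _; rewrite !mxE eqxx andbT.
    by case: eqP => _; rewrite ?subrr ?subr0 ?expr0n ?expr1n.
  by rewrite cs /nu1; field; apply/andP; split; apply: lt0r_neq0; lra.
by exists 0; rewrite cs; ring.
Qed.

(** The isotropic vector [cusp1] was found by solving for its image [cusp_row1]
    under the form: that image is supported on few coordinates, is orthogonal to
    [delta_k - delta_0], and pairs with opposite signs with the walls
    [one_col - delta_1] and [one_col - delta_3]. *)
Definition cusp_row1 : vec :=
  5 *: unitv 0 + 14 *: unitv 1 + 3 *: unitv 2 + (-15) *: unitv 3 + 5 *: unitv k.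

Definition cusp1 : vec := cusp_row1 + (-26) *: one_col k + (-12) *: sgn_col k.

Lemma form1_cusp1 : form1 k *m cusp1 = cusp_row1.
Proof.
have K_gt0 := K_gt0 k_even k_ge4.
have [le0 le1 le2 le3] : [/\ 0 <= k, 1 <= k, 2 <= k & 3 <= k]%N by split; lia.
have -> : cusp_row1 = cusp1 - (-12) *: sgn_col k - (-26) *: one_col k.
  by rewrite /cusp1; move: (_ *: _) (_ *: _) => x y; rewrite addrK addrK.
have -> : -12 = alt cusp1 / (K + 2).
  rewrite /cusp1 /cusp_row1 !altD !altZ alt_one alt_sgn !alt_unitv // (sgn_max k_even) //.
  by field; apply: lt0r_neq0; lra.
have -> : -26 = csum cusp1 / (K + 1).
  rewrite /cusp1 /cusp_row1 !csumD !csumZ csum_one csum_sgn !csum_unitv.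
  by field; apply: lt0r_neq0; lra.
by rewrite form1_mul.
Qed.

Lemma cusp_row1_mul x : cusp_row1^T *m x =
  (5 * x (inord 0) 0 + 14 * x (inord 1) 0 + 3 * x (inord 2) 0
   - 15 * x (inord 3) 0 + 5 * x (inord k) 0)%:M.
Proof.
rewrite /cusp_row1 !linearD /= !linearZ /= !mulmxDl -!scalemxAl !tr_unitv_mul.
by rewrite !scale_scalar_mx -!raddfD /= mulNr.
Qed.

Lemma cusp1E j : (j <= k)%N -> cusp1 (inord j) 0 =
  5 * (j == 0)%:R + 14 * (j == 1)%:R + 3 * (j == 2)%:R - 15 * (j == 3)%:R
   + 5 * (j == k)%:R - 26 - 12 * (-1) ^+ j.
Proof.
move=> jk; have [le0 le1 le2 le3] : [/\ 0 <= k, 1 <= k, 2 <= k & 3 <= k]%N by split; lia.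
rewrite /cusp1 /cusp_row1 -!unitvE //.
rewrite !mxE inordK ?ltnS //; ring.
Qed.

Lemma thin1 a b :
  exponent_poly R a = map_poly intr (poly_a1 k) ->
  exponent_poly R b = map_poly intr (poly_b1 k) ->
  thin (hypergeometric_group R k.+1 a b).
Proof.
move=> ap bq; have K_gt0 := K_gt0 k_even k_ge4.
have maxE : ord_max = inord k :> 'I_k.+1 by apply: val_inj; rewrite /= inordK.
have Fsym := form1_sym k.
have trF : cusp1^T *m form1 k = cusp_row1^T.
  by rewrite -form1_cusp1 trmx_mul Fsym.
have [k0 k1 k2 k3] : [/\ (k == 0)%N = false, (k == 1)%N = false, (k == 2)%N = false & (k == 3)%N = false].
  by split; lia.
have [k0' k1' k2' k3'] : [/\ (0 == k)%N = false, (1 == k)%N = false, (2 == k)%N = false & (3 == k)%N = false].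
  by split; lia.
have [le0 le1 le2 le3] : [/\ 0 <= k, 1 <= k, 2 <= k & 3 <= k]%N by split; lia.
have scalar0 (z : rat) : z = 0 -> z%:M = 0 :> 'M[rat]_1 by move=> ->; rewrite raddf0.
pose u := unitv k - unitv 0.
have uE j : (j <= k)%N -> u (inord j) 0 = (j == k)%:R - (j == 0)%:R.
  by move=> jk; rewrite -(unitvE (leqnn k) jk) -(unitvE (leq0n k) jk) mxE [X in _ + X]mxE.
have su : sqn u = 2.
  rewrite /sqn (bigD1 (inord 0)) //= (bigD1 (inord k)) //=; last first.
    by rewrite -(inj_eq val_inj) /= !inordK // eq_sym k0'.
  rewrite !uE // k0 k0' !eqxx big1 => [|j /andP[j0 jk]]; first by rewrite /=; ring.
  rewrite -(inord_val j) uE; last by rewrite -ltnS.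
  move: j0 jk; rewrite -!(inj_eq val_inj) /= !inordK // => /negPf-> /negPf->.
  by rewrite subr0 expr0n.
have cu : csum u = 0 by rewrite /u -scaleN1r csumD csumZ !csum_unitv; ring.
have au : alt u = 0.
  by rewrite /u -scaleN1r altD altZ !alt_unitv // (sgn_max k_even); ring.
clearbody u.
have wE i j : (i <= k)%N -> (j <= k)%N ->
    (one_col k - unitv i) (inord j) 0 = 1 - (j == i)%:R.
  by move=> ik jk; rewrite -(unitvE ik jk) mxE [X in _ + X]mxE [X in X - _]mxE.
have lw i : (i < k)%N -> (l *m (one_col k - unitv i)) 0 0 = 1.
  move=> ik; rewrite delta_row_mul maxE wE ?(ltnW ik) //.
  by rewrite gtn_eqF // subr0.
have le : (l *m cusp1) 0 0 = - 33.
  rewrite delta_row_mul maxE cusp1E // k0 k1 k2 k3 eqxx (sgn_max k_even).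
  by rewrite /=; ring.
have dot i : (i <= k)%N -> (cusp_row1^T *m (one_col k - unitv i)) 0 0 =
    12 - (5 * (i == 0)%:R + 14 * (i == 1)%:R + 3 * (i == 2)%:R - 15 * (i == 3)%:R
    + 5 * (i == k)%:R).
  move=> ik; rewrite cusp_row1_mul !wE // [LHS]mxE eqxx mulr1n ![_ == i]eq_sym.
  by ring.
have dot1 : (cusp_row1^T *m (one_col k - unitv 1)) 0 0 = - 2.
  by rewrite dot // k1' /=; ring.
have dot3 : (cusp_row1^T *m (one_col k - unitv 3)) 0 0 = 27.
  by rewrite dot // k3' /=; ring.
apply: (@thin_eichler R k a b _ _ (form1 k) (@walls1 k) l cusp1 u
  (one_col k - unitv 1) (one_col k - unitv 3) ap bq).
- exact: Fsym.
- exact: form1_signature.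
- exact: AF.
- exact: BF.
- apply/eqP => /(congr1 (fun g => (g *m one_col k) 0 0)).
  rewrite A_mul0 B_mul0 !mxE => /eqP; rewrite -subr_eq0 opprK.
  by rewrite (_ : 1 + 1 = 2%:R) // pnatr_eq0.
- move=> w Tw; rewrite delta_row_mul; apply/eqP => w0.
  by have := walls1_sign k_even k_ge4 Tw; rewrite w0 mul0r ltxx.
- exact: walls1_side_A.
- exact: walls1_side_B.
- rewrite trF cusp_row1_mul !cusp1E // k0 k1 k2 k3 k0' k1' k2' k3' !eqxx (sgn_max k_even) //=.
  by apply: scalar0; ring.
- rewrite trF cusp_row1_mul !uE // k0 k0' k1' k2' k3' !eqxx /=.
  by apply: scalar0; ring.
- by rewrite quadform1 cu au su expr0n /= !mul0r !subr0.
- exact: walls1_mem.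
- exact: walls1_mem.
- by rewrite trF le dot1 lw.
- by rewrite trF le dot3 lw.
Qed.
End FamilyI.

(** * Transport to another basis *)

Lemma same_side_conj n (T : 'cV[rat]_n -> Prop) (l : 'rV_n) (M g g' : 'M[rat]_n) :
  M *m g = g' *m M -> same_side T l g' -> same_side (fun w => T (M *m w)) (l *m M) g.
Proof.
move=> Mg [g'T g'l]; split=> [w|w w' Tw Tw']; first by rewrite mulmxA Mg -mulmxA.
by have := g'l _ _ Tw Tw'; rewrite !mulmxA -!(mulmxA l g') -Mg !mulmxA.
Qed.

Lemma signature_conj n (D M : 'M[rat]_n) p q : M \in unitmx ->
  has_signature D p q -> has_signature (M^T *m D *m M) p q.
Proof.
move=> Mu [S [d [Su E cp cq]]]; exists (invmx M *m S), d; split=> //.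
  by rewrite unitmx_mul unitmx_inv Mu.
have MS : M *m (invmx M *m S) = S by rewrite mulKVmx.
by rewrite -E -[in RHS]MS !trmx_mul !mulmxA.
Qed.

Lemma isometry_conj n (D M g g' : 'M[rat]_n) : M *m g = g' *m M ->
  g'^T *m D *m g' = D -> g^T *m (M^T *m D *m M) *m g = M^T *m D *m M.
Proof.
move=> Mg gD; rewrite -[in RHS]gD -!mulmxA -Mg !mulmxA -!trmx_mul Mg.
by rewrite trmx_mul.
Qed.

(** The criterion when the pair of companion matrices is conjugate by [M] to
    a pair given in rational coordinates, in which [T], [e] and [u] are
    described. *)
Lemma thin_eichler_model (R : realType) n (a b : seq rat) (p q : {poly int})
    (M A' B' D : 'M[rat]_n.+1) (T : 'cV[rat]_n.+1 -> Prop) (l : 'rV[rat]_n.+1)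
    (e u w1 w2 : 'cV[rat]_n.+1) :
    exponent_poly R a = map_poly intr p -> exponent_poly R b = map_poly intr q ->
    M \in unitmx ->
    M *m ratmx (companion n.+1 p) = A' *m M ->
    M *m ratmx (companion n.+1 q) = B' *m M ->
    D^T = D -> has_signature D n 1 ->
    A'^T *m D *m A' = D -> B'^T *m D *m B' = D -> A' != B' ->
    (forall w, T w -> (l *m w) 0 0 != 0) ->
    same_side T l A' -> same_side T l B' ->
    e^T *m D *m e = 0 -> e^T *m D *m u = 0 -> 0 < quadform D u ->
    T w1 -> T w2 ->
    0 < (l *m w1) 0 0 * ((l *m e) 0 0 * (e^T *m D *m w1) 0 0) ->
    (l *m w2) 0 0 * ((l *m e) 0 0 * (e^T *m D *m w2) 0 0) < 0 ->
  thin (hypergeometric_group R n.+1 a b).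
Proof.
move=> ap bq Mu MA MB Dsym Dsgn AD BD AB l0 As Bs ee eu uu Tw1 Tw2 h1 h2.
have Fsgn := signature_conj Mu Dsgn.
have MK (x : 'cV_n.+1) : M *m (invmx M *m x) = x by rewrite mulKVmx.
have VD (x y : 'cV_n.+1) : (invmx M *m x)^T *m (M^T *m D *m M) *m (invmx M *m y) = x^T *m D *m y.
  by rewrite -[in RHS](MK x) -[in RHS](MK y) !trmx_mul !mulmxA.
have lV (x : 'cV_n.+1) : (l *m M) *m (invmx M *m x) = l *m x by rewrite -mulmxA MK.
apply: (@thin_eichler R n a b p q (M^T *m D *m M) (fun w => T (M *m w)) (l *m M)
   (invmx M *m e) (invmx M *m u) (invmx M *m w1) (invmx M *m w2) ap bq).
- by rewrite !trmx_mul trmxK Dsym mulmxA.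
- exact: Fsgn.
- exact: isometry_conj MA AD.
- exact: isometry_conj MB BD.
- apply: contra AB => /eqP pq; apply/eqP.
  by rewrite -[A'](mulmxK Mu) -MA pq MB mulmxK.
- by move=> w /l0; rewrite mulmxA.
- exact: same_side_conj MA As.
- exact: same_side_conj MB Bs.
- by rewrite VD.
- by rewrite VD.
- by rewrite /quadform VD.
- by rewrite MK.
- by rewrite MK.
- by rewrite !lV VD.
- by rewrite !lV VD.
Qed.

(** * Second family: a model of the two matrices *)

Section PolyII.
Variables (K : comNzRingType) (N : nat).
Hypothesis (N_gt1 : (1 < N)%N).

Definition poly_a2 : {poly K} := ('X + 1) * ('X^N + 1).
Definition poly_b2 : {poly K} := ('X - 1) ^+ 2 * ('X^(N.-1) - 1).

Lemma poly_a2_monic : poly_a2 \is monic.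
Proof. by rewrite rpredM ?monicXaddC ?monicXnaddC //; lia. Qed.

Lemma poly_b2_monic : poly_b2 \is monic.
Proof. by rewrite rpredM ?rpredX ?monicXsubC ?monicXnsubC //; lia. Qed.

Lemma size_poly_a2 : size poly_a2 = N.+2.
Proof.
rewrite size_monicM ?monicXaddC //.
  by rewrite size_XaddC size_XnaddC //; lia.
by rewrite -size_poly_eq0 size_XnaddC //; lia.
Qed.

Lemma size_poly_b2 : size poly_b2 = N.+2.
Proof.
rewrite size_monicM ?rpredX ?monicXsubC //; last first.
  by rewrite -size_poly_eq0 size_XnsubC //; lia.
rewrite expr2 size_monicM ?monicXsubC ?polyXsubC_eq0 //.
by rewrite size_XsubC size_XnsubC //; lia.
Qed.
End PolyII.

Section Columns.
Variable N : nat.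
Implicit Types (f : nat -> rat) (w : 'cV[rat]_N.+1).

(** Columns are described by functions on nat, so that shifting coordinates
    does not involve ordinals.  Coordinate 0 is the timelike coordinate [t], and
    [z_1, ..., z_N] are spacelike. *)
Definition colf f : 'cV[rat]_N.+1 := \col_i f i.
Definition ent w (i : nat) : rat := w (inord i) 0.

Lemma ent_colf f i : (i <= N)%N -> ent (colf f) i = f i.
Proof. by move=> iN; rewrite /ent mxE inordK. Qed.

Lemma colf_ent w : colf (ent w) = w.
Proof. by apply/colP => i; rewrite mxE /ent inord_val. Qed.

Lemma eq_colf f g : (forall i, (i <= N)%N -> f i = g i) -> colf f = colf g.
Proof. by move=> fg; apply/colP => i; rewrite !mxE fg // -ltnS. Qed.

Lemma colfD f g : colf f + colf g = colf (fun i => f i + g i).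
Proof. by apply/colP => i; rewrite !mxE. Qed.

Lemma colfB f g : colf f - colf g = colf (fun i => f i - g i).
Proof. by apply/colP => i; rewrite !mxE. Qed.

Lemma colfN f : - colf f = colf (fun i => - f i).
Proof. by apply/colP => i; rewrite !mxE. Qed.

Lemma entD w w' i : ent (w + w') i = ent w i + ent w' i.
Proof. by rewrite /ent mxE. Qed.

Lemma entZ a w i : ent (a *: w) i = a * ent w i.
Proof. by rewrite /ent mxE. Qed.

Lemma ent_sum (h : nat -> rat) w :
  \sum_(i < N.+1) h i * w i 0 = \sum_(0 <= i < N.+1) h i * ent w i.
Proof. by rewrite big_mkord; apply: eq_bigr => i _; rewrite /ent inord_val. Qed.

Lemma sum_delta w m : (m <= N)%N ->
  \sum_(i < N.+1) (m == i)%:R * w i 0 = ent w m.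
Proof.
move=> mN; rewrite (bigD1 (inord m)) //= inordK // eqxx mul1r big1 ?addr0 // => i im.
rewrite (_ : _ == _ = false) ?mul0r //; apply: contraNF im => /eqP->.
by rewrite inord_val.
Qed.

End Columns.

Section FamilyII.
Variable (N : nat).
Hypotheses (N_even : ~~ odd N) (N_ge4 : (4 <= N)%N).

Local Notation vec := ('cV[rat]_N.+1).
Local Notation mat := ('M[rat]_N.+1).
Local Notation colf := (@colf N).
Implicit Types (f : nat -> rat) (w : vec).

(** [t] changes sign, and the coordinates [z] undergo the negative of a
    negacyclic shift, whose [N]-th power is -1 as [N] is even: the characteristic
    polynomial is [(X + 1) (X^N + 1)]. *)
Definition stepf f (i : nat) : rat :=
  if (i == 0)%N then - f 0 else if (i == 1)%N then f N else - f i.-1.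

Definition rot2 : mat := \matrix_(i, j) stepf (fun m => (m == j)%:R) i.

Lemma ent_rot2 w i : (i <= N)%N -> ent (rot2 *m w) i = stepf (ent w) i.
Proof.
move=> iN; rewrite /ent mxE /stepf.
under eq_bigr => j _ do rewrite mxE /stepf inordK //.
case: eqP => [_|i0]; last case: eqP => [_|i1].
- by under eq_bigr => j _ do rewrite mulNr; rewrite sumrN sum_delta.
- by rewrite sum_delta.
- by under eq_bigr => j _ do rewrite mulNr; rewrite sumrN sum_delta //; lia.
Qed.

Lemma rot2_colf f : rot2 *m colf f = colf (stepf f).
Proof.
rewrite -[LHS]colf_ent; apply: eq_colf => i iN; rewrite ent_rot2 // /stepf.
by rewrite !ent_colf //; lia.
Qed.

(** The start vector of the Krylov basis, extended to a sequence with
    [antiper (m + N) = - antiper m]; the powers of [rot2] slide a window of length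
    [N] along it. *)
Definition antiper (m : nat) : rat :=
  if odd m then 0 else if (m == 0)%N then 1 else if (m <= N)%N then -1 else 1.

Definition trajf (j i : nat) : rat :=
  (-1) ^+ j * (if (i == 0)%N then -1 else antiper (i.-1 + N - j)).

Definition start2 : vec := colf (trajf 0).

Lemma antiperN m : (m < N)%N -> antiper (m + N) = - antiper m.
Proof.
move=> mN; rewrite /antiper oddD (negPf N_even) addbF.
have -> : (m + N == 0)%N = false by lia.
have -> : (m + N <= N)%N = (m == 0)%N by lia.
by rewrite (ltnW mN); case: (odd m); case: (m == 0)%N; rewrite ?oppr0 ?opprK.
Qed.

Lemma rot2_trajf j : (j < N)%N -> stepf (trajf j) =1 trajf j.+1.
Proof.
move=> jN [|[|i]]; rewrite /stepf /trajf /=.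
- by rewrite exprS; ring.
- have -> : (N == 0) = false by lia.
  have -> : (N.-1 + N - j = (N.-1 - j) + N)%N by lia.
  rewrite antiperN; last by lia.
  by rewrite exprS (_ : 0 + N - j.+1 = N.-1 - j)%N; [ring | lia].
- by rewrite exprS (_ : i.+1 + N - j.+1 = i + N - j)%N; [ring | lia].
Qed.

Lemma rot2X_start j : (j <= N)%N -> rot2 ^+ j *m start2 = colf (trajf j).
Proof.
elim: j => [|j IHj] jN; first by rewrite expr0 mul1mx.
rewrite exprS -mulmxE -mulmxA IHj ?(ltnW jN) // rot2_colf.
by apply: eq_colf => i _; rewrite rot2_trajf.
Qed.

(** The pairing with the root [v2] of the reflection, for the form [form2]. *)
Definition ell2 w : rat := - ent w 0 / 2 + (ent w 1 + ent w 2) / 2.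
Definition vec2f (i : nat) : rat := if (i == 0)%N then 8 else if (i <= 2)%N then 2 else 0.

Definition l2f (i : nat) : rat :=
  if (i == 0)%N then -1/2 else if (i <= 2)%N then 1/2 else 0.
Definition l2 : 'rV[rat]_N.+1 := \row_i l2f i.
Definition v2 : vec := colf vec2f.

Lemma l2_mul w : (l2 *m w) 0 0 = ell2 w.
Proof.
rewrite mxE; under eq_bigr => i _ do rewrite mxE.
rewrite ent_sum big_ltn // big_ltn; last by lia.
rewrite big_ltn; last by lia.
rewrite big_nat big1 => [|i /andP[i3 _]]; rewrite /l2f /ell2; first by rewrite /=; field.
have [-> ->] : (i == 0)%N = false /\ (i <= 2)%N = false by split; lia.
by rewrite mul0r.
Qed.

Lemma l2_v2 : ell2 v2 = -2.
Proof. by rewrite /ell2 !ent_colf /vec2f //=; lia. Qed.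

(** This is what dictates the start vector: [ell2] becomes the last coordinate
    in the Krylov basis. *)
Lemma l2_traj j : (j <= N)%N -> ell2 (colf (trajf j)) = (j == N)%:R.
Proof.
move=> jN; rewrite /ell2 !ent_colf ?(leq_trans _ N_ge4) // /trajf /=.
have [-> | j_neqN] := eqVneq j N.
  rewrite add0n subnn add1n subSn // subnn /antiper /=.
  by rewrite -signr_odd (negPf N_even) /= expr0.
suff E : antiper (0 + N - j) + antiper (1 + N - j) = -1.
  by rewrite -mulrDr E /=; field.
have even_lt m : (0 < m <= N)%N -> antiper m = if odd m then 0 else -1.
  by move=> /andP[m0 mN]; rewrite /antiper mN (_ : (m == 0)%N = false) //; lia.
have [-> | j_gt0] := posnP j.
  by rewrite !subn0 add0n add1n /antiper /= N_even (negPf N_even) leqnn; case: (N) N_ge4.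
rewrite !even_lt ?add0n ?add1n ?subSn //=; try lia.
by case: odd; rewrite ?add0r ?addr0.
Qed.

Lemma horner_a2 : horner_mx rot2 (poly_a2 rat N) *m start2 = 0.
Proof.
rewrite /poly_a2 rmorphM !rmorphD !rmorph1 rmorphXn /= horner_mx_X -mulmxE -mulmxA.
rewrite [(rot2 ^+ N + 1) *m _]mulmxDl mul1mx rot2X_start // colfD.
rewrite (@eq_colf N _ (fun i => if (i == 0)%N then - 2 else 0)) => [|i iN].
  rewrite mulmxDl mul1mx rot2_colf colfD -[RHS]colf_ent; apply: eq_colf => i iN.
  rewrite /ent mxE /stepf; case: i iN => [|[|i]] _ //=.
  by rewrite (_ : (N == 0)%N = false) //; lia.
rewrite /trajf -signr_odd (negPf N_even) expr0 !mul1r subn0.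
case: i iN => [|i] iN //=; by rewrite antiperN // addnK subrr.
Qed.

(** Through [krylov_companion_rank1] this identifies the second companion matrix
    with [rot2] times the reflection in [v2]. *)
Lemma horner_b2 : horner_mx rot2 (poly_b2 rat N) *m start2 = - (rot2 *m v2).
Proof.
rewrite /poly_b2 rmorphM rmorphXn !rmorphB !rmorph1 rmorphXn /= horner_mx_X.
have N1_odd : odd N.-1 by case: (N) N_even N_ge4 => //= m; rewrite negbK.
rewrite expr2 -!mulmxE -mulmxA.
rewrite [(rot2 ^+ _ - 1) *m _]mulmxBl mul1mx rot2X_start ?leq_pred // colfB.
rewrite (@eq_colf N _ (fun i => if (i == 0)%N then 2 else if (i == 1)%N then 1
   else if odd i then - 1 else 1)) => [|i iN].
  rewrite -mulmxA !(mulmxBl rot2) !mul1mx !rot2_colf !colfB !rot2_colf !colfB.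
  rewrite colfN; apply: eq_colf => i iN.
  have [N0 N1] : (N == 0)%N = false /\ (N == 1)%N = false by split; lia.
  have [M0 M1 N2] : [/\ (N.-1 == 0)%N = false, (N.-1 == 1)%N = false & (N <= 2)%N = false].
    by split; lia.
  rewrite /stepf /vec2f; case: i iN => [|[|[|[|i]]]] iN /=.
  - by ring.
  - by rewrite ?N0 ?N1 (negPf N_even) ?M0 ?M1 ?N1_odd N2 /=; ring.
  - by rewrite ?N0 ?N1 (negPf N_even) ?M0 ?M1 ?N1_odd /=; ring.
  - by ring.
  - by case: odd => /=; ring.
rewrite /trajf -signr_odd N1_odd expr1 expr0.
case: i iN => [|i] iN; first by rewrite /=; ring.
rewrite /= subn0 antiperN // (_ : i + N - N.-1 = i.+1)%N; last by lia.
rewrite /antiper iN ltnW //=; case: i iN => [|i] iN /=; first by ring.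
by case: odd => /=; ring.
Qed.

End FamilyII.

(** * Second family: the invariant form *)

Section FamilyII.
Variable (N : nat).
Hypotheses (N_even : ~~ odd N) (N_ge4 : (4 <= N)%N).

Local Notation vec := ('cV[rat]_N.+1).
Local Notation mat := ('M[rat]_N.+1).
Local Notation colf := (@colf N).
Implicit Types (f : nat -> rat) (w x y : vec).

Definition dot2 x y : rat := \sum_(1 <= i < N.+1) ent x i * ent y i.
Definition diag2 (i : nat) : rat := if (i == 0)%N then - 1 / 16 else 1 / 4.
Definition form2 : mat := diag_mx (\row_i diag2 i).

Lemma form2_sym : form2^T = form2. Proof. exact: tr_diag_mx. Qed.

Lemma form2_mul x y : (x^T *m form2 *m y) 0 0 = dot2 x y / 4 - ent x 0 * ent y 0 / 16.
Proof.
rewrite mxE (eq_bigr (fun i : 'I_N.+1 => (diag2 i * ent x i) * y i 0)) => [|i _].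
  rewrite (@ent_sum N (fun i => diag2 i * ent x i)) big_ltn // big_nat (eq_bigr (fun i => (ent x i * ent y i) / 4)).
    by rewrite -big_nat -mulr_suml /diag2 /dot2 /=; field.
  by move=> i /andP[i0 _]; rewrite /diag2 ifF; [field | lia].
rewrite mul_mx_diag !mxE /ent inord_val; ring.
Qed.

Lemma form2_signature : has_signature form2 N 1.
Proof.
exists 1%:M, (\row_i diag2 i); split; first exact: unitmx1.
- by rewrite trmx1 mul1mx mulmx1.
- rewrite (_ : [set i | _]%SET = [set~ ord0]%SET) ?cardsC1 ?card_ord //.
  apply/setP => i; rewrite !inE mxE /diag2 -(inj_eq val_inj) /=.
  by case: eqP.
- rewrite (_ : [set i | _]%SET = [set ord0]%SET) ?cards1 //.
  apply/setP => i; rewrite !inE mxE /diag2 -(inj_eq val_inj) /=.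
  by case: eqP.
Qed.

Lemma dot2_rot x : dot2 (rot2 N *m x) (rot2 N *m x) = dot2 x x.
Proof.
rewrite /dot2 big_ltn; last by lia.
rewrite ent_rot2 ?(leq_trans _ N_ge4) // [in RHS]big_nat_recr /=; last by lia.
rewrite addrC; congr (_ + _); rewrite big_add1 /= big_nat [in RHS]big_nat.
apply: eq_bigr => i /andP[i1 iN]; rewrite ent_rot2 // /stepf /=.
by rewrite (_ : (i.+1 == 1)%N = false) ?mulrNN //; lia.
Qed.

Lemma rot2_isometry : (rot2 N)^T *m form2 *m rot2 N = form2.
Proof.
apply: isometry_of_quadform => [|x]; first exact: form2_sym.
by rewrite /quadform !form2_mul dot2_rot !ent_rot2 // /stepf /=; ring.
Qed.

Definition refl2 : mat := 1%:M + v2 N *m l2 N.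

Lemma l2E : l2 N = (v2 N)^T *m form2.
Proof.
rewrite mul_mx_diag; apply/rowP => i; rewrite !mxE /l2f /vec2f /diag2.
by case: eqP => // _; case: leqP => _ //; rewrite mul0r.
Qed.

Lemma l2_v2_mx : l2 N *m v2 N = (-2)%:M.
Proof. by rewrite [LHS]mx11_scalar l2_mul // l2_v2. Qed.

Lemma refl2_isometry : refl2^T *m form2 *m refl2 = form2.
Proof.
have Dv : form2 *m v2 N = (l2 N)^T by rewrite l2E trmx_mul trmxK form2_sym.
rewrite /refl2 [(1%:M + _)^T]linearD /= trmx1 trmx_mul mulmxDl mul1mx -mulmxA -l2E.
rewrite mulmxDr mulmx1 mulmxDl mulmxA Dv -[(l2 N)^T *m l2 N *m _]mulmxA.
rewrite [l2 N *m (v2 N *m _)]mulmxA l2_v2_mx mul_scalar_mx -scalemxAr.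
rewrite addrA -[RHS]addr0 -addrA -addrA; congr (_ + _).
by rewrite addrA -mulr2n -scaler_nat -scalerDl subrr scale0r.
Qed.

Lemma refl2_mul w : refl2 *m w = w + ell2 w *: v2 N.
Proof.
rewrite /refl2 mulmxDl mul1mx -mulmxA [l2 N *m w]mx11_scalar l2_mul //.
by rewrite mul_mx_scalar.
Qed.

Lemma ell2_refl w : ell2 (refl2 *m w) = - ell2 w.
Proof.
rewrite refl2_mul -!l2_mul // mulmxDr -scalemxAr mxE [X in _ + X]mxE l2_v2_mx.
by rewrite [X in _ * X]mxE eqxx mulr1n; ring.
Qed.

Lemma refl2K w : refl2 *m (refl2 *m w) = w.
Proof.
rewrite [LHS]refl2_mul ell2_refl refl2_mul scaleNr addrK //.
Qed.

Definition kry2 : mat := krylov (rot2 N) (start2 N).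

Lemma kry2_a : kry2 *m companion N.+1 (poly_a2 _ N) = rot2 N *m kry2.
Proof.
apply: krylov_companion; last exact: horner_a2.
  by apply: poly_a2_monic; lia.
by apply: size_poly_a2; lia.
Qed.

Lemma l2_kry2 : l2 N *m kry2 = (delta_mx ord_max 0)^T.
Proof.
apply/rowP => j; transitivity ((l2 N *m col j kry2) 0 0).
  by rewrite !mxE; apply: eq_bigr => i _; rewrite !mxE.
have jN : (j <= N)%N by rewrite -ltnS.
rewrite col_krylov rot2X_start // l2_mul // l2_traj //.
by rewrite !mxE andbT -(inj_eq val_inj).
Qed.

Lemma kry2_b : kry2 *m companion N.+1 (poly_b2 _ N) = rot2 N *m refl2 *m kry2.
Proof.
apply: (@krylov_companion_rank1 _ _ _ _ (poly_a2 _ N)).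
- by apply: poly_a2_monic; lia.
- by apply: poly_b2_monic; lia.
- by apply: size_poly_a2; lia.
- by apply: size_poly_b2; lia.
- exact: kry2_a.
- exact: horner_a2.
- exact: l2_kry2.
- exact: horner_b2.
Qed.

Lemma kry2_unit : kry2 \in unitmx.
Proof. exact: krylov_unit kry2_a l2_kry2. Qed.

End FamilyII.

(** * Second family: reduction to a set of walls *)

Section FamilyII.
Variables (R : realType) (N : nat).
Hypotheses (N_even : ~~ odd N) (N_ge4 : (4 <= N)%N).

Local Notation vec := ('cV[rat]_N.+1).
Implicit Types (f : nat -> rat) (w x y : vec).

Let dot x y : rat := dot2 x y / 4 - ent x 0 * ent y 0 / 16.

(** The reflection reverses [ell2] and [rot2] reverses [t], so a set of walls on
    which [ell2] and [t] have opposite signs satisfies [same_side]. *)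
Lemma thin2 a b (T : vec -> Prop) (e u w1 w2 : vec) :
    exponent_poly R a = poly_a2 _ N -> exponent_poly R b = poly_b2 _ N ->
    (forall w, T (rot2 N *m w) <-> T w) ->
    (forall w, T w -> T (refl2 N *m w)) ->
    (forall w, T w -> ell2 w * ent w 0 < 0) ->
    dot e e = 0 -> dot e u = 0 -> 0 < dot u u ->
    T w1 -> T w2 ->
    0 < ell2 w1 * (ell2 e * dot e w1) ->
    ell2 w2 * (ell2 e * dot e w2) < 0 ->
  thin (hypergeometric_group R N.+1 a b).
Proof.
move=> ap bq TA TC Tl ee eu uu Tw1 Tw2 h1 h2.
have TC' w : T (refl2 N *m w) <-> T w.
  by split=> [/TC|/TC//]; rewrite refl2K.
have l0 w : T w -> (l2 N *m w) 0 0 != 0.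
  move=> /Tl; rewrite l2_mul //; apply: contraTneq => ->.
  by rewrite mul0r ltxx.
have As : same_side T (l2 N) (rot2 N).
  split=> // w w' Tw Tw'; rewrite !l2_mul //.
  have neg v : T v -> ell2 v * ell2 (rot2 N *m v) < 0.
    move=> Tv; have := Tl _ Tv; have := Tl _ ((TA v).2 Tv).
    rewrite ent_rot2 // /stepf /= mulrN oppr_lt0 => lA lv.
    have v0 : ent v 0 != 0 by apply: contraTneq lv => ->; rewrite mulr0 ltxx.
    rewrite -(pmulr_llt0 _ (_ : 0 < ent v 0 ^+ 2)) ?exprn_even_gt0 //.
    have -> : ell2 v * ell2 (rot2 N *m v) * ent v 0 ^+ 2 =
      ell2 v * ent v 0 * (ell2 (rot2 N *m v) * ent v 0) by ring.
    by rewrite nmulr_rlt0.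
  by rewrite nmulr_rgt0 ?neg.
have Cs : same_side T (l2 N) (refl2 N).
  split=> // w w' Tw Tw'; rewrite !l2_mul // !ell2_refl // !(mulrN, mulNr) opprK.
  have := l0 _ Tw; have := l0 _ Tw'; rewrite !l2_mul // => y0 x0.
  by apply: mulr_gt0; rewrite -expr2 exprn_even_gt0.
have pE : map_poly intr (poly_a2 int N) = poly_a2 _ N :> {poly R[i]}.
  by rewrite /poly_a2 rmorphM !rmorphD rmorph1 /= map_polyX map_polyXn.
have pQ : map_poly intr (poly_a2 int N) = poly_a2 _ N :> {poly rat}.
  by rewrite /poly_a2 rmorphM !rmorphD rmorph1 /= map_polyX map_polyXn.
have qE : map_poly intr (poly_b2 int N) = poly_b2 _ N :> {poly R[i]}.
  by rewrite /poly_b2 rmorphM rmorphXn !rmorphB rmorph1 /= map_polyX map_polyXn.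
have qQ : map_poly intr (poly_b2 int N) = poly_b2 _ N :> {poly rat}.
  by rewrite /poly_b2 rmorphM rmorphXn !rmorphB rmorph1 /= map_polyX map_polyXn.
have Fs := form2_sym N.
have Bs := same_sideM l0 As Cs.
apply: (@thin_eichler_model R N a b (poly_a2 _ N) (poly_b2 _ N) (kry2 N)
  (rot2 N) (rot2 N *m refl2 N) (form2 N) T (l2 N) e u w1 w2).
- by rewrite pE.
- by rewrite qE.
- exact: kry2_unit.
- by rewrite -map_companion pQ kry2_a.
- by rewrite -map_companion qQ kry2_b.
- exact: Fs.
- exact: form2_signature.
- exact: rot2_isometry.
- rewrite trmx_mul -!mulmxA (mulmxA (form2 N)) (mulmxA (rot2 N)^T) (mulmxA (rot2 N)^T).
  by rewrite rot2_isometry // mulmxA refl2_isometry.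
- apply/eqP => /(congr1 (fun g => ent (g *m v2 N) 0)).
  rewrite -mulmxA refl2_mul // l2_v2 // ent_rot2 // ent_rot2 // /stepf /=.
  by rewrite entD entZ !ent_colf.
- exact: l0.
- exact: As.
- exact: Bs.
- by rewrite [LHS]mx11_scalar form2_mul // -/(dot e e) ee raddf0.
- by rewrite [LHS]mx11_scalar form2_mul // -/(dot e u) eu raddf0.
- by rewrite /quadform form2_mul.
- exact: Tw1.
- exact: Tw2.
- by rewrite !l2_mul // form2_mul.
- by rewrite !l2_mul // form2_mul.
Qed.

End FamilyII.

(** * Second family: the sign condition *)

Section Invariants.
Variables (N : nat).
Hypotheses (N_even : ~~ odd N) (N_ge4 : (4 <= N)%N).

Local Notation vec := ('cV[rat]_N.+1).
Implicit Types (w x y : vec).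

Definition norm2 w : rat := dot2 w w - ent w 0 ^+ 2 / 4.

Lemma norm2E w : norm2 w = 4 * quadform (form2 N) w.
Proof. by rewrite /quadform form2_mul // /norm2; field. Qed.

Lemma norm2_rot w : norm2 (rot2 N *m w) = norm2 w.
Proof. by rewrite !norm2E (quadform_isometry _ (rot2_isometry N_even N_ge4)). Qed.

Lemma norm2_refl w : norm2 (refl2 N *m w) = norm2 w.
Proof. by rewrite !norm2E (quadform_isometry _ (refl2_isometry N_even N_ge4)). Qed.

Lemma ent_refl w i : (i <= N)%N -> ent (refl2 N *m w) i = ent w i + ell2 w * vec2f i.
Proof. by move=> iN; rewrite refl2_mul // entD entZ ent_colf. Qed.

(** If [ell2 w * t >= 0] then [(z_1 + z_2) t >= t^2], hence
    [z_1^2 + z_2^2 >= t^2 / 2]; the other squares contribute at least [N - 2], and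
    the norm is too large. *)
Lemma ell2_sign w :
    (forall i, (2 < i <= N)%N -> 1 <= ent w i ^+ 2) -> ent w 0 != 0 ->
    norm2 w < ent w 0 ^+ 2 / 4 + (N%:R - 2) ->
  ell2 w * ent w 0 < 0.
Proof.
move=> z_ge1 t_neq0; rewrite /norm2 /dot2 big_ltn; last by lia.
rewrite big_ltn; last by lia.
set r := \sum_(3 <= i < N.+1) _ => sq_lt.
have r_ge : N%:R - 2 <= r.
  have -> : N%:R - 2 = \sum_(3 <= i < N.+1) 1 :> rat.
    by rewrite sumr_const_nat subSS natrB //; lia.
  by rewrite big_nat /r [leRHS]big_nat; apply: ler_sum => i /andP[i3 iN]; rewrite -expr2 z_ge1 // i3.
move: sq_lt; rewrite /ell2; set t := ent w 0; set x := ent w 1; set y := ent w 2 => sq_lt.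
have t2 : 0 < t ^+ 2 by rewrite exprn_even_gt0.
rewrite ltNge; apply/negP => lt_ge0.
have xy : 2 * (x * x + y * y) < t ^+ 2 by lra.
have xyt : t ^+ 2 <= (x + y) * t by rewrite expr2 in t2 xy *; lra.
have : (x + y) ^+ 2 < t ^+ 2.
  by have := sqr_ge0 (x - y); rewrite !expr2 in xy *; lra.
nra.
Qed.
End Invariants.

(** * Second family: walls in rank at least 7 *)

Definition odd_rat (x : rat) : Prop := exists m : int, x = (2 * m + 1)%:~R.

Lemma odd_ratN x : odd_rat (- x) <-> odd_rat x.
Proof.
by split=> -[m mE]; exists (- m - 1); [rewrite -[x]opprK|]; rewrite mE -intrN; congr (_%:~R); ring.
Qed.

Lemma odd_rat_sqr x : odd_rat x -> 1 <= x ^+ 2.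
Proof. by move=> [m ->]; rewrite -rmorphXn ler1z; nia. Qed.

Section Large.
Variables (R : realType) (N : nat).
Hypotheses (N_even : ~~ odd N) (N_ge6 : (6 <= N)%N).

Local Notation vec := ('cV[rat]_N.+1).
Implicit Types (w x y : vec).

Let N_ge4 : (4 <= N)%N. Proof. by lia. Qed.

(** The congruence [t = 4 mod 8] makes [ell2] integral, and keeps [t] away
    from 0. *)
Definition walls2 w : Prop :=
  [/\ exists j : int, ent w 0 = (8 * j + 4)%:~R,
      forall i, (0 < i <= N)%N -> odd_rat (ent w i) &
      norm2 w = N%:R - 4].

Lemma walls2_rot w : walls2 (rot2 N *m w) <-> walls2 w.
Proof.
have z0 : ent (rot2 N *m w) 0 = - ent w 0 by rewrite ent_rot2.
have z1 : ent (rot2 N *m w) 1 = ent w N by rewrite ent_rot2 //; lia.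
have zS i : (0 < i < N)%N -> ent (rot2 N *m w) i.+1 = - ent w i.
  by case: i => // i iN; rewrite ent_rot2.
rewrite /walls2 norm2_rot // z0.
split=> -[[j jE] w_odd nw]; split=> //.
- by exists (- j - 1); rewrite -[LHS]opprK jE -intrN; congr (_%:~R); ring.
- move=> i /andP[i0 iN]; have [->|i_neqN] := eqVneq i N.
    by rewrite -z1; apply: w_odd; lia.
  by apply/odd_ratN; rewrite -zS; [apply: w_odd|]; lia.
- by exists (- j - 1); rewrite jE -intrN; congr (_%:~R); ring.
- case=> [//|[|i]] /andP[_ iN]; first by rewrite z1; apply: w_odd; lia.
  by rewrite zS //; apply/odd_ratN/w_odd; lia.
Qed.

Lemma walls2_refl w : walls2 w -> walls2 (refl2 N *m w).
Proof.
move=> [[j jE] w_odd nw]; have [m1 m1E] := w_odd 1%N (ltac:(lia)).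
have [m2 m2E] := w_odd 2%N (ltac:(lia)).
have lE : ell2 w = (m1 + m2 - 4 * j - 1)%:~R.
  by rewrite /ell2 jE m1E m2E !(intrD, intrM, intrB, rmorphN) /=; field.
split; last by rewrite norm2_refl.
- exists (j + (m1 + m2 - 4 * j - 1)); rewrite ent_refl // lE jE (_ : vec2f 0 = 8%:~R) // -intrM -intrD.
  by congr (_%:~R); rewrite /=; ring.
- move=> i /andP[i0 iN]; rewrite ent_refl // lE /vec2f gtn_eqF //.
  have [m ->] := w_odd i (ltac:(lia)).
  case: ifP => _; last by exists m; rewrite mulr0 addr0.
  exists (m + (m1 + m2 - 4 * j - 1)); rewrite (_ : 2 = 2%:~R :> rat) // -intrM -intrD.
  by congr (_%:~R); ring.
Qed.

Lemma walls2_sign w : walls2 w -> ell2 w * ent w 0 < 0.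
Proof.
move=> [[j jE] w_odd nw]; apply: ell2_sign => //.
- by move=> i iN; apply/odd_rat_sqr/w_odd; lia.
- by rewrite jE intr_eq0; lia.
- rewrite nw; have := sqr_ge0 (ent w 0); lra.
Qed.

Lemma dot2_seq (s : seq rat) x : (size s <= N.+1)%N ->
  dot2 (colf N (nth 0 s)) x = \sum_(1 <= i < size s) nth 0 s i * ent x i.
Proof.
move=> sN; rewrite /dot2; have [s0|s_gt0] := posnP (size s).
  rewrite s0 [RHS]big_geq // big_nat big1 // => i /andP[i1 iN].
  by rewrite ent_colf // nth_default ?mul0r // s0.
rewrite (big_cat_nat _ (n := size s)) //= [X in _ + X]big_nat [X in _ + X]big1.
  rewrite addr0 big_nat [RHS]big_nat; apply: eq_bigr => i /andP[i0 iN].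
  by rewrite ent_colf //; lia.
by move=> i /andP[si iN]; rewrite ent_colf // nth_default // mul0r.
Qed.

Lemma thin2_large a b :
  exponent_poly R a = poly_a2 _ N -> exponent_poly R b = poly_b2 _ N ->
  thin (hypergeometric_group R N.+1 a b).
Proof.
move=> ap bq.
(* An isotropic vector, a spacelike vector orthogonal to it, and two walls [w s]
   pairing with the former as 7/2 s - 3. *)
pose se : seq rat := [:: 12; 3; 2; 3; 2; 3; 1].
pose su : seq rat := [:: 0; 1; 0; -1].
pose w (s : int) : vec := colf N (fun i => if (i == 0)%N then 4 else s%:~R).
have Tw s : s = 1 \/ s = - 1 -> walls2 (w s).
  move=> s1; split.
  - by exists 0; rewrite ent_colf.
  - move=> i /andP[i0 iN]; rewrite ent_colf // gtn_eqF //.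
    by case: s1 => ->; [exists 0 | exists (-1)].
  - rewrite /norm2 /dot2 big_nat (eq_bigr (fun=> 1)) => [|i /andP[i0 iN]].
      by rewrite -big_nat sumr_const_nat subn1 ent_colf //=; field.
    by rewrite ent_colf // gtn_eqF //; case: s1 => ->.
have ew s : dot2 (colf N (nth 0 se)) (w s) = 14 * s%:~R.
  rewrite dot2_seq // unlock /= !ent_colf //=; try lia.
  by ring.
have eE i : (i <= 6)%N -> ent (colf N (nth 0 se)) i = nth 0 se i.
  by move=> i6; rewrite ent_colf //; lia.
have uE i : (i <= 6)%N -> ent (colf N (nth 0 su)) i = nth 0 su i.
  by move=> i6; rewrite ent_colf //; lia.
have wE s i : (i <= 6)%N -> ent (w s) i = if (i == 0)%N then 4 else s%:~R.
  by move=> i6; rewrite ent_colf //; lia.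
have le : ell2 (colf N (nth 0 se)) = - 7 / 2 by rewrite /ell2 !eE //=; field.
have lw s : ell2 (w s) = s%:~R - 2 by rewrite /ell2 !wE //=; field.
have dw s : dot2 (colf N (nth 0 se)) (w s) / 4 -
    ent (colf N (nth 0 se)) 0 * ent (w s) 0 / 16 = 7 / 2 * s%:~R - 3.
  by rewrite ew eE // wE //=; field.
apply: (@thin2 R N N_even N_ge4 a b walls2 (colf N (nth 0 se)) (colf N (nth 0 su)) (w 1) (w (-1)) ap bq).
- exact: walls2_rot.
- exact: walls2_refl.
- exact: walls2_sign.
- by rewrite dot2_seq //= unlock /= !eE //=; field.
- by rewrite dot2_seq //= unlock /= !eE // !uE //=; field.
- by rewrite dot2_seq //= ?unlock /= ?uE //=; lia.
- by apply: Tw; left.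
- by apply: Tw; right.
- rewrite le lw dw; lra.
- rewrite le lw dw; lra.
Qed.
End Large.

(** * Second family: walls in rank 5 *)

Local Notation state := (int * int * int * int * int)%type.

Section Residues.
Definition residue (c : state) : state :=
  let: (b, x, y, z, t) := c in
  ((b %% 2)%Z, (x %% 8)%Z, (y %% 8)%Z, (z %% 8)%Z, (t %% 8)%Z).

Definition rot_state (c : state) : state :=
  let: (b, x, y, z, t) := c in (- b, t, - x, - y, - z).

Definition unrot_state (c : state) : state :=
  let: (b, x, y, z, t) := c in (- b, - y, - z, - t, x).

Definition refl_state (c : state) : state :=
  let: (b, x, y, z, t) := c in
  let l := ((x + y) %/ 2)%Z - 4 * b in (b + l, x + 2 * l, y + 2 * l, z, t).

(** Residues of [(t / 8; z)] modulo [(2; 8)].  Norm 4 and odd coordinates [z]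
    would still allow [t = 0] with all [z_i = 1] or [-1], where the sign of
    [ell2] is not determined.  This class, given by representatives modulo
    rotation, is stable under both generators and contains no such residue. *)
Definition state_class : seq state :=
  flatten [seq traject (residue \o rot_state) c 8 |
    c <- [:: (1, 1, 7, 1, 7); (1, 1, 5, 3, 7); (0, 1, 7, 3, 3); (0, 3, 3, 5, 3)]].

Lemma residue_rot c : residue (rot_state c) = residue (rot_state (residue c)).
Proof.
by move: c => [[[[b x] y] z] t] /=; congr (_, _, _, _, _); lia.
Qed.

Lemma residue_unrot c : residue (unrot_state c) = residue (unrot_state (residue c)).
Proof.
by move: c => [[[[b x] y] z] t] /=; congr (_, _, _, _, _); lia.
Qed.

Lemma residue_refl c : let: (b, x, y, z, t) := c in
  ((x + y) %% 2)%Z = 0 ->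
  residue (refl_state c) = residue (refl_state (residue c)).
Proof.
by move: c => [[[[b x] y] z] t] /= xy; congr (_, _, _, _, _); lia.
Qed.

Lemma state_class_closed : all (fun c =>
  [&& residue (rot_state c) \in state_class,
      residue (unrot_state c) \in state_class &
      residue (refl_state c) \in state_class]) state_class.
Proof. by vm_compute. Qed.

Lemma state_class_odd : all (fun c => let: (b, x, y, z, t) := c in
  all (fun m => m %% 2 == 1)%Z [:: x; y; z; t]) state_class.
Proof. by vm_compute. Qed.

Lemma state_class_neq0 : all (fun c => let: (b, x, y, z, t) := c in
  (b != 0) || has (fun m => m \notin [:: 1; 7]) [:: x; y; z; t]) state_class.
Proof. by vm_compute. Qed.
End Residues.

Section Rank5.
Variables (R : realType).

Local Notation vec := ('cV[rat]_5).
Implicit Types (w : vec) (c : state).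

Definition state_fun c (i : nat) : rat :=
  let: (b, x, y, z, t) := c in (nth 0 [:: 8 * b; x; y; z; t] i)%:~R.
Definition state_vec c : vec := colf 4 (state_fun c).

Definition walls5 w : Prop := exists c,
  [/\ w = state_vec c, norm2 w = 4 & residue c \in state_class].

Lemma ent_state c i : (i <= 4)%N -> ent (state_vec c) i = state_fun c i.
Proof. exact: ent_colf. Qed.

Lemma rot2_state c : rot2 4 *m state_vec c = state_vec (rot_state c).
Proof.
rewrite /state_vec rot2_colf //; apply: eq_colf.
case: c => [[[[b x] y] z] t] [|[|[|[|[|i]]]]] // _; rewrite /stepf /= -?rmorphN //.
by rewrite mulrN.
Qed.

Lemma unrot_stateK w c : rot2 4 *m w = state_vec c -> w = state_vec (unrot_state c).
Proof.
move=> wc; have E i : (i <= 4)%N -> state_fun c i = stepf 4 (ent w) i.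
  by move=> i4; rewrite -ent_state // -wc ent_rot2.
move: (E 0 isT) (E 1 isT) (E 2 isT) (E 3 isT) (E 4 isT) => {E wc}.
case: c => [[[[b x] y] z] t]; rewrite /stepf /= => E0 E1 E2 E3 E4.
rewrite -[w]colf_ent; apply: eq_colf; case=> [|[|[|[|[|i]]]]] // _ /=.
- by rewrite mulrN intrN E0 opprK.
- by rewrite intrN E2 opprK.
- by rewrite intrN E3 opprK.
- by rewrite intrN E4 opprK.
Qed.

Lemma state_class_mem c : residue c \in state_class ->
  [/\ residue (rot_state c) \in state_class,
      residue (unrot_state c) \in state_class &
      ((let: (b, x, y, z, t) := c in x + y) %% 2)%Z = 0 /\
      residue (refl_state c) \in state_class].
Proof.
move=> cC; have /and3P[c1 c2 c3] := allP state_class_closed _ cC.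
rewrite residue_rot residue_unrot; split=> //.
have := allP state_class_odd _ cC; have := @residue_refl c.
case: c {cC c1 c2} c3 => [[[[b x] y] z] t] c3 /= cE /and4P[/eqP x1 /eqP y1 _ _].
have xy : ((x + y) %% 2)%Z = 0 by lia.
by split=> //; rewrite cE.
Qed.

Lemma walls5_rot w : walls5 (rot2 4 *m w) <-> walls5 w.
Proof.
split=> -[c [wc nw /state_class_mem[c1 c2 _]]].
  exists (unrot_state c); split=> //; first exact: unrot_stateK.
  by rewrite -nw norm2_rot.
exists (rot_state c); split=> //; first by rewrite wc rot2_state.
by rewrite norm2_rot.
Qed.

Lemma walls5_refl w : walls5 w -> walls5 (refl2 4 *m w).
Proof.
move=> [c [wc nw /state_class_mem[_ _ [xy c3]]]].
exists (refl_state c); split=> //; last by rewrite norm2_refl.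
have lE : ell2 w = (let: (b, x, y, z, t) := c in ((x + y) %/ 2)%Z - 4 * b)%:~R.
  rewrite /ell2 wc !ent_state //; move: xy {c3 wc nw}.
  case: c => [[[[b x] y] z] t] xy /=.
  have -> : (8 * b)%:~R = 8 * b%:~R :> rat by rewrite intrM.
  rewrite intrB intrM.
  have := congr1 (fun m : int => m%:~R : rat) (divz_eq (x + y) 2).
  rewrite /= xy addr0 intrM intrD => ->; by field.
rewrite -[LHS]colf_ent; apply: eq_colf => i i4; rewrite ent_refl // lE wc ent_state //.
move: i4; case: c {c3 xy wc nw lE} => [[[[b x] y] z] t].
set l := _ - _; case: i => [|[|[|[|[|i]]]]] // _; rewrite /vec2f /=.
all: by rewrite ?mulr0 ?addr0 ?(intrD, intrM) /=; ring.
Qed.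

Lemma norm2_state b x y z t :
  norm2 (state_vec (b, x, y, z, t)) =
  (x ^+ 2 + y ^+ 2 + z ^+ 2 + t ^+ 2 - 16 * b ^+ 2)%:~R.
Proof.
rewrite /norm2 /dot2 unlock /= !ent_state //= !(intrD, intrM, rmorphN, rmorphXn) /=.
by field.
Qed.

Lemma sqr_odd_eq1 (m : int) : (m %% 2)%Z = 1 -> m ^+ 2 <= 1 -> m = 1 \/ m = -1.
Proof. by move=> m_odd m2; have : -1 <= m <= 1; [nia | lia]. Qed.

Lemma walls5_sign w : walls5 w -> ell2 w * ent w 0 < 0.
Proof.
move=> [[[[[b x] y] z] t] [wc nw cC]].
have w0 : ent w 0 = (8 * b)%:~R by rewrite wc ent_state.
have [x_odd y_odd z_odd t_odd] :
    [/\ (x %% 2)%Z = 1, (y %% 2)%Z = 1, (z %% 2)%Z = 1 & (t %% 2)%Z = 1].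
  have := allP state_class_odd _ cC.
  by move=> /and5P[/eqP x1 /eqP y1 /eqP z1 /eqP t1 _]; split; lia.
have nE : x ^+ 2 + y ^+ 2 + z ^+ 2 + t ^+ 2 = 4 + 16 * b ^+ 2.
  move: nw; rewrite wc norm2_state => /(@intr_inj rat _ 4); lia.
have sqr_ge1 (m : int) : m != 0 -> 1 <= m ^+ 2.
  by move=> m0; rewrite -gtz0_ge1 exprn_even_gt0.
have b_neq0 : b != 0.
  apply/eqP => b0; have := allP state_class_neq0 _ cC; rewrite /= b0.
  have [x1 y1 z1 t1] : [/\ 1 <= x ^+ 2, 1 <= y ^+ 2, 1 <= z ^+ 2 & 1 <= t ^+ 2].
    by split; apply: sqr_ge1; lia.
  have unit_residue (m : int) : (m %% 2)%Z = 1 -> m ^+ 2 <= 1 ->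
      (m %% 8)%Z \in [:: 1; 7].
    by move=> m1 /(sqr_odd_eq1 m1)[]->.
  by rewrite !unit_residue //; lia.
have b2 : 1 <= (b%:~R : rat) ^+ 2 by rewrite -rmorphXn ler1z sqr_ge1.
apply: ell2_sign => // [i i4||].
- suff : odd_rat (ent w i) by exact: odd_rat_sqr.
  have odd_int (m : int) : (m %% 2)%Z = 1 -> odd_rat m%:~R.
    by move=> m1; exists (m %/ 2)%Z; congr (_%:~R); lia.
  rewrite wc ent_state; last by lia.
  by case: i i4 => [|[|[|[|[|i]]]]] //= _; apply: odd_int.
- by rewrite w0 intr_eq0; lia.
- by rewrite nw w0 intrM; lra.
Qed.

Lemma thin2_rank5 a b :
  exponent_poly R a = poly_a2 _ 4 -> exponent_poly R b = poly_b2 _ 4 ->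
  thin (hypergeometric_group R 5 a b).
Proof.
move=> ap bq.
(* An isotropic vector [e] and a spacelike [u] orthogonal to it; the walls [w s]
   pair with [e] as 13/2 s - 6. *)
pose e : vec := colf 4 (nth 0 [:: 12; -4; 4; -2; 0]).
pose u : vec := colf 4 (nth 0 [:: 0; 0; 0; 0; 1]).
pose w (s : int) := state_vec (1, s * -3, s * 3, s * -1, s * -1).
have eE i : (i <= 4)%N -> ent e i = nth 0 [:: 12; -4; 4; -2; 0] i by exact: ent_colf.
have uE i : (i <= 4)%N -> ent u i = nth 0 [:: 0; 0; 0; 0; 1] i by exact: ent_colf.
have wE s i : (i <= 4)%N -> ent (w s) i = nth 0 [:: 8; s%:~R * - 3; s%:~R * 3; - s%:~R; - s%:~R] i.
  move=> i4; rewrite ent_state // /state_fun.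
  by case: i i4 => [|[|[|[|[|i]]]]] //= _; rewrite ?intrM //= ?mulrN1.
have dE (x y : vec) : dot2 x y = ent x 1 * ent y 1 + ent x 2 * ent y 2
    + ent x 3 * ent y 3 + ent x 4 * ent y 4 :> rat.
  by rewrite /dot2 unlock /=; ring.
have le : ell2 e = - 6 by rewrite /ell2 !eE //=; field.
have lw s : ell2 (w s) = - 4 by rewrite /ell2 !wE //=; field.
have dw s : dot2 e (w s) / 4 - ent e 0 * ent (w s) 0 / 16 = 13 / 2 * s%:~R - 6.
  by rewrite dE !eE // !wE //=; field.
have Tw s : s = 1 \/ s = - 1 -> walls5 (w s).
  by case=> ->; eexists; (split; [reflexivity | rewrite norm2_state | vm_compute]).
apply: (@thin2 R 4 isT isT a b walls5 e u (w 1) (w (-1)) ap bq).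
- exact: walls5_rot.
- exact: walls5_refl.
- exact: walls5_sign.
- by rewrite dE !eE //=; field.
- by rewrite dE !eE // !uE //=; field.
- by rewrite dE !uE /=; [lra|..].
- by apply: Tw; left.
- by apply: Tw; right.
- rewrite le lw dw; lra.
- rewrite le lw dw; lra.
Qed.

End Rank5.

Theorem theorem1 (R : realType) (n : nat) (n_ge5 : (5 <= n)%N) (n_odd : odd n) :
  thin (hypergeometric_group R n (alpha1 n) (beta1 n)) /\
  thin (hypergeometric_group R n (alpha2 n) (beta2 n)).
Proof.
case: n n_ge5 n_odd => // k k_ge4 k_even; split.
  have k_gt0 : (0 < k)%N by lia.
  by apply: thin1 => //; [apply: exponent_poly_alpha1_int | apply: exponent_poly_beta1_int].
have ap : exponent_poly R (alpha2 k.+1) = poly_a2 _ k.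
  by rewrite exponent_poly_alpha2 //; lia.
have bp : exponent_poly R (beta2 k.+1) = poly_b2 _ k.
  by rewrite exponent_poly_beta2 ?subSS ?subn1 //; lia.
have [k_ge6|k_lt6] := leqP 6 k; first exact: thin2_large.
have k4 : k = 4 by lia.
by move: ap bp; rewrite k4; apply: thin2_rank5.
Qed.
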